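(* Consider hollow heaps of any of the three kinds described in the context (multi-root, one-root, or two-parent), augmented with rebuilding as described in the context for a fixed constant $c>1$. Then, for any sequence of operations starting with no heaps, the amortized time per operation is $O(1)$ for each operation other than delete-min and delete, and $O(\log n)$ for each delete-min or delete on a heap of $n$ items; moreover the space used by each heap is $O(n)$, where $n$ is its number of items.
   Context: Heaps. A heap stores a finite set of items, each with a key from a totally ordered universe, and supports: make-heap(), find-min($h$), insert($e,k,h$), delete-min($h$), meld($h_1,h_2$) (of item-disjoint heaps), decrease-key($e,k,h$) (given $e$ in $h$ with key greater than $k$, change its key to $k$), delete($e,h$), with the usual meanings; heaps passed as arguments are destroyed; decrease-key and delete are given the location of $e$. Nodes. Nodes hold items: each node holds at most one item, and is full if it holds one and hollow otherwise; each item in a heap is held by exactly one node; a newly created node is full and a hollow node never becomes full again. Each node $u$ has a key $u.key$ (the current key of its item if full, else the key its item had just before leaving $u$) and a non-negative integer rank. Heap-ordered means $v.key\le w.key$ for every parent-child arc $(v,w)$; a root is a node with no parent. A link of two full roots makes the one of larger key (ties arbitrary) a child (loser) of the other (winner); a ranked link is between roots of equal rank and increases the winner's rank by one; an unranked link is between any two full roots and changes no ranks. Common operations. insert creates a new full node of rank 0 and melds it in; delete($e,h$) makes the node holding $e$ hollow, and if that node was the minimum node (the root, in the one-root and two-parent kinds), repeatedly destroys hollow roots (children left without parents become roots), then does ranked links while two roots have equal rank, then (except in the multi-root kind, where the minimum root is recorded) unranked links until one root remains; delete-min deletes the item in the minimum node. decrease-key($e,k,h$) with $u$ the node holding $e$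 (unless $u$ is a root, in which case one may just change its key) creates a new node $v$ holding $e$ with key $k$ and rank $\max\{0,u.rank-2\}$, makes $u$ hollow, and melds $v$ in, where: - Multi-root hollow heap: a set of heap-ordered trees with a pointer to a minimum-key full root; meld unites the tree sets; decrease-key moves to $v$ each child of $u$ of rank less than $v.rank$. - One-root hollow heap: a single heap-ordered tree with full root; meld is an unranked link of the roots; children are ranked/unranked according to the link they lost; decrease-key moves to $v$ each ranked child of $u$ of rank less than $v.rank$ and any subset of unranked children. - Two-parent hollow heap: a heap-ordered dag with a single, full root; meld is an unranked link of the roots; decrease-key moves no children but adds the arc $(v,u)$, giving $u$ a second parent. Rebuilding. For each heap, track $N$ (number of nodes, full and hollow) and $n$ (number of items). Whenever $N>cn$, rebuild the heap so that it contains no hollow nodes, in time $O(N)$, by either of: (1) destroy every hollow node, make each full node into a one-node heap of rank 0, and meld these heaps until one heap remains; or (2) in the two-parent case first remove one parent of every node having two, then give every full node rank 0, make each full non-root node a child of its nearest full proper ancestor (its child status becoming unranked), and destroy all hollow nodes. *)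

(* Defs.v *)
From HB Require Import structures.
From mathcomp Require Import all_boot all_order all_algebra finmap.
From mathcomp Require Import reals exp.

Set Implicit Arguments.
Unset Strict Implicit.
Unset Printing Implicit Defensive.

Import Order.TTheory GRing.Theory Num.Theory.
Local Open Scope fset_scope.
Local Open Scope fmap_scope.
Local Open Scope nat_scope.

Inductive kind := MultiRoot | OneRoot | TwoParent.

(* Nondeterministic small steps annotated with their time.  [exhaust] runs
   steps for as long as one is possible. *)
Section Iteration.
Context {G : Type}.

Inductive iterate (st : G -> nat -> G -> Prop) : G -> nat -> G -> Prop :=
| iterate0 g : iterate st g 0 g
| iterateS g t g1 t1 g2 :
    st g t g1 -> iterate st g1 t1 g2 -> iterate st g (t + t1) g2.

Definition exhaust (st : G -> nat -> G -> Prop) (g : G) (t : nat) (g' : G) :=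
  iterate st g t g' /\ ~ (exists t1 g1, st g' t1 g1).

End Iteration.

Section HollowHeaps.
Context {d : Order.disp_t} {K : orderType d} {I : Type}.

(* A node is hollow when [item] is [None]; [key] is kept when it becomes
   hollow.  [ranked] says whether the last link lost by the node was ranked, so
   it is meaningful only for a node that has a parent. *)
Record node := Node {
  item : option I;
  key : K;
  rank : nat;
  parents : seq nat;
  ranked : bool
}.

(* Nodes are named by natural numbers; an arc (p, u) of the dag is an occurrence
   of p in [parents] of u. *)
Definition graph := {fmap nat -> node}.

Definition set_item i (a : node) :=
  Node i (key a) (rank a) (parents a) (ranked a).
Definition set_key k (a : node) :=
  Node (item a) k (rank a) (parents a) (ranked a).
Definition set_parents ps (a : node) :=
  Node (item a) (key a) (rank a) ps (ranked a).

Implicit Types (g : graph) (u v w p : nat).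

Definition upd g u (f : node -> node) : graph :=
  if g.[? u] is Some a then g.[u <- f a] else g.

Definition map_nodes (f : nat -> node -> node) g : graph :=
  [fmap u : domf g => f (val u) (g u)].

Definition item_of g u : option I := obind item g.[? u].
Definition rank_of g u : nat := oapp rank 0 g.[? u].
Definition parents_of g u : seq nat := oapp parents [::] g.[? u].
Definition ranked_of g u : bool := oapp ranked false g.[? u].
Definition full g u : bool := isSome (item_of g u).
Definition is_root g u : bool := (u \in domf g) && nilp (parents_of g u).
Definition key_le g u w : bool :=
  if (g.[? u], g.[? w]) is (Some a, Some b) then (key a <= key b)%O else false.

Definition full_nodes g : {fset nat} := [fset u in domf g | full g u].
Definition root_nodes g : {fset nat} := [fset u in domf g | is_root g u].
Definition children g u : {fset nat} :=
  [fset w in domf g | u \in parents_of g w].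
Definition num_nodes g : nat := #|` domf g|.
Definition num_items g : nat := #|` full_nodes g|.
Definition num_arcs g : nat := \sum_(u <- domf g) size (parents_of g u).

Definition full_root g u : bool := is_root g u && full g u.

(* w is the winner, l the loser. *)
Definition can_link g w l : bool :=
  [&& full_root g w, full_root g l, w != l & key_le g w l].

Definition attach g w l (b : bool) : graph :=
  upd g l (fun a => Node (item a) (key a) (rank a) [:: w] b).

Inductive ranked_link g : nat -> graph -> Prop :=
| Ranked_link w l :
    can_link g w l -> rank_of g w = rank_of g l ->
    ranked_link g 1 (upd (attach g w l true) w
      (fun a => Node (item a) (key a) (rank a).+1 (parents a) (ranked a))).

Inductive unranked_link g : nat -> graph -> Prop :=
| Unranked_link w l :
    can_link g w l -> unranked_link g 1 (attach g w l false).

(* One unit of time for the node and one for each of its outgoing arcs. *)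
Inductive destroy_hollow_root g : nat -> graph -> Prop :=
| Destroy u :
    is_root g u -> ~~ full g u ->
    destroy_hollow_root g (1 + #|` children g u|)
      (map_nodes (fun _ a => set_parents [seq p <- parents a | p != u] a)
                 g.[~ u]).

(* [minnode] is [None] exactly for the empty heap; in the one-root and
   two-parent kinds it is the root. *)
Record heap := Heap { nodes : graph; minnode : option nat }.

Definition empty_heap : heap := Heap [fmap] None.

Definition is_min_root g (m : option nat) : Prop :=
  if m is Some u
  then full_root g u /\ (forall w, full_root g w -> key_le g u w)
  else forall w, ~~ full_root g w.

Definition smaller g u w m : Prop :=
  (m = u \/ m = w) /\ key_le g m u /\ key_le g m w.

(* Melding two heaps with minimum nodes a and b whose nodes are all in g; m is
   the minimum node of the result. *)
Inductive join (kd : kind) g (a b : nat) : graph -> nat -> Prop :=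
| Join_multi m : kd = MultiRoot -> smaller g a b m -> join kd g a b g m
| Join_link w l :
    kd <> MultiRoot -> (w, l) = (a, b) \/ (w, l) = (b, a) -> can_link g w l ->
    join kd g a b (attach g w l false) w.

Inductive meld_heaps (kd : kind) (h1 h2 : heap) : heap -> Prop :=
| Meld_nil_l : minnode h1 = None -> meld_heaps kd h1 h2 h2
| Meld_nil_r : minnode h2 = None -> meld_heaps kd h1 h2 h1
| Meld_cons m1 m2 g m :
    minnode h1 = Some m1 -> minnode h2 = Some m2 ->
    join kd (catf (nodes h1) (nodes h2)) m1 m2 g m ->
    meld_heaps kd h1 h2 (Heap g (Some m)).

Definition new_node (e : I) (k : K) (r : nat) : node :=
  Node (Some e) k r [::] false.

(* [shift kd g u v t g'] treats the arcs in decrease-key: u is the node being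
   left, v the new node, which is in g with its rank already set.  The ranked
   children of a node are listed by decreasing rank, before the unranked ones:
   finding where to cut the list takes one unit of time for each ranked child
   that stays with u, and the part cut off is moved in a single step. *)
Inductive shift (kd : kind) g u v : nat -> graph -> Prop :=
| Shift_move (S : {fset nat}) :
    S `<=` children g u ->
    match kd with
    | MultiRoot =>
        forall w, w \in children g u -> (w \in S) = (rank_of g w < rank_of g v)
    | OneRoot =>
        forall w, w \in children g u -> ranked_of g w ->
          (w \in S) = (rank_of g w < rank_of g v)
    | TwoParent => False
    end ->
    shift kd g u v
      (1 + #|` [fset w in children g u | ranked_of g w && (w \notin S)]|)
      (map_nodes (fun w a =>
         if w \in S
         then set_parents [seq if p == u then v else p | p <- parents a] a
         else a) g)
| Shift_arc :
    kd = TwoParent ->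
    shift kd g u v 1 (upd g u (fun a => set_parents (rcons (parents a) v) a)).

(* v is the name used if a node is created.  A root of a one-root or two-parent
   heap cannot be replaced, since the hollow root could not be linked. *)
Inductive decrease_key_heap (kd : kind) v (e : I) (k : K) (h : heap) :
    nat -> heap -> Prop :=
| Decrease_root u a m m' :
    (nodes h).[? u] = Some a -> item a = Some e -> (k < key a)%O ->
    is_root (nodes h) u -> minnode h = Some m ->
    smaller (upd (nodes h) u (set_key k)) m u m' ->
    decrease_key_heap kd v e k h 1
      (Heap (upd (nodes h) u (set_key k)) (Some m'))
| Decrease_node u a m m' t g1 g2 :
    (nodes h).[? u] = Some a -> item a = Some e -> (k < key a)%O ->
    kd = MultiRoot \/ ~~ is_root (nodes h) u -> minnode h = Some m ->
    shift kd
      (upd (nodes h) u (set_item None)).[v <- new_node e k (rank a - 2)] u v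
      t g1 ->
    join kd g1 m v g2 m' ->
    decrease_key_heap kd v e k h (1 + t) (Heap g2 (Some m')).

(* Between the two linking phases the roots are kept in an array indexed by
   rank: filling it takes one unit of time per root, and scanning it one unit
   per cell. *)
Definition array_size g : nat := (\max_(u <- root_nodes g) rank_of g u).+1.

Definition restore (kd : kind) g (t : nat) (g' : graph) : Prop :=
  exists g1 g2 t1 t2 t3,
    [/\ exhaust destroy_hollow_root g t1 g1,
        exhaust ranked_link g1 t2 g2,
        (if kd is MultiRoot then g' = g2 /\ t3 = 0
         else exhaust unranked_link g2 t3 g') &
        t = t1 + #|` root_nodes g1| + t2 + array_size g2 + t3].

Inductive delete_node (kd : kind) u (h : heap) : nat -> heap -> Prop :=
| Delete_other :
    full (nodes h) u -> minnode h <> Some u ->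
    delete_node kd u h 1
      (Heap (upd (nodes h) u (set_item None)) (minnode h))
| Delete_min t g m :
    full (nodes h) u -> minnode h = Some u ->
    restore kd (upd (nodes h) u (set_item None)) t g -> is_min_root g m ->
    delete_node kd u h (1 + t) (Heap g m).

(* First method: single nodes, melded one pair at a time in any order. *)
Definition single_nodes g : graph :=
  map_nodes (fun _ a => Node (item a) (key a) 0 [::] false)
            g.[& full_nodes g].

(* Second method.  [prune g g1]: of two parents, one (either) is removed. *)
Definition prune g g1 : Prop :=
  domf g1 = domf g /\
  forall u a, g.[? u] = Some a ->
    exists ps, g1.[? u] = Some (set_parents ps a) /\
      (if size (parents a) <= 1 then ps = parents a
       else exists2 p, p \in parents a & ps = [:: p]).

(* [nearest_full g u ps]: ps is [:: p] if p is the nearest full proper ancestor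
   of u, and [::] if u has none (a root or, in the multi-root kind only, a node
   whose proper ancestors are all hollow). *)
Inductive nearest_full g : nat -> seq nat -> Prop :=
| Nearest_root u : parents_of g u = [::] -> nearest_full g u [::]
| Nearest_here u p :
    parents_of g u = [:: p] -> full g p -> nearest_full g u [:: p]
| Nearest_up u p ps :
    parents_of g u = [:: p] -> ~~ full g p -> nearest_full g p ps ->
    nearest_full g u ps.

Definition contract g g' : Prop :=
  domf g' = full_nodes g /\
  exists2 g1, prune g g1 &
    forall u a, u \in full_nodes g -> g.[? u] = Some a ->
      exists2 ps, nearest_full g1 u ps &
        g'.[? u] = Some (Node (item a) (key a) 0 ps false).

(* Both methods visit every node and every arc once. *)
Inductive rebuild (kd : kind) (h : heap) : nat -> heap -> Prop :=
| Rebuild_disassemble t g m :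
    (if kd is MultiRoot then g = single_nodes (nodes h) /\ t = 0
     else exhaust unranked_link (single_nodes (nodes h)) t g) ->
    is_min_root g m ->
    rebuild kd h (num_nodes (nodes h) + num_arcs (nodes h) + t) (Heap g m)
| Rebuild_contract g :
    contract (nodes h) g ->
    rebuild kd h (num_nodes (nodes h) + num_arcs (nodes h))
      (Heap g (minnode h)).

Definition needs_rebuild {R : realType} (c : R) (h : heap) : bool :=
  (c * (num_items (nodes h))%:R < (num_nodes (nodes h))%:R)%R.

Inductive rebuild_if {R : realType} (kd : kind) (c : R) (h : heap) :
    nat -> heap -> Prop :=
| Rebuild_no : ~~ needs_rebuild c h -> rebuild_if kd c h 0 h
| Rebuild_yes t h' :
    needs_rebuild c h -> rebuild kd h t h' -> rebuild_if kd c h t h'.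

(* Space is counted in nodes and arcs, each of constant size. *)
Definition space_used (h : heap) : nat := num_nodes (nodes h) + num_arcs (nodes h).

(* All existing heaps; x, y : nat are heap names. *)
Definition state := {fmap nat -> heap}.

Definition fresh_node (s : state) v : Prop :=
  forall x h, s.[? x] = Some h -> v \notin domf (nodes h).

Definition holds_item (h : heap) (e : I) : Prop :=
  exists u, item_of (nodes h) u = Some e.

Inductive op :=
| MakeHeap (x : nat)
| FindMin (x : nat)
| Insert (e : I) (k : K) (x : nat)
| DeleteMin (x : nat)
| Meld (x y : nat)  (* the result is called x *)
| DecreaseKey (e : I) (k : K) (x : nat)
| Delete (e : I) (x : nat).

Inductive step {R : realType} (kd : kind) (c : R) (s : state) :
    op -> nat -> state -> Prop :=
| Step_make x :
    x \notin domf s -> step kd c s (MakeHeap x) 1 s.[x <- empty_heap]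
| Step_find x : x \in domf s -> step kd c s (FindMin x) 1 s
| Step_insert e k x h v h1 t h2 :
    s.[? x] = Some h -> ~ holds_item h e -> fresh_node s v ->
    meld_heaps kd (Heap [fmap].[v <- new_node e k 0] (Some v)) h h1 ->
    rebuild_if kd c h1 t h2 ->
    step kd c s (Insert e k x) (1 + t) s.[x <- h2]
| Step_delete_min x h u t1 h1 t2 h2 :
    s.[? x] = Some h -> minnode h = Some u ->
    delete_node kd u h t1 h1 -> rebuild_if kd c h1 t2 h2 ->
    step kd c s (DeleteMin x) (t1 + t2) s.[x <- h2]
| Step_meld x y hx hy h1 t h2 :
    x != y -> s.[? x] = Some hx -> s.[? y] = Some hy ->
    (forall e, ~ (holds_item hx e /\ holds_item hy e)) ->
    meld_heaps kd hx hy h1 -> rebuild_if kd c h1 t h2 ->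
    step kd c s (Meld x y) (1 + t) s.[~ y].[x <- h2]
| Step_decrease_key e k x h v t1 h1 t2 h2 :
    s.[? x] = Some h -> fresh_node s v ->
    decrease_key_heap kd v e k h t1 h1 -> rebuild_if kd c h1 t2 h2 ->
    step kd c s (DecreaseKey e k x) (t1 + t2) s.[x <- h2]
| Step_delete e x h u t1 h1 t2 h2 :
    s.[? x] = Some h -> item_of (nodes h) u = Some e ->
    delete_node kd u h t1 h1 -> rebuild_if kd c h1 t2 h2 ->
    step kd c s (Delete e x) (t1 + t2) s.[x <- h2].

Definition items_in (s : state) x : nat :=
  oapp (fun h => num_items (nodes h)) 0 s.[? x].

(* The bound claimed for an operation, up to a constant factor, where the
   number of items is taken just before the operation; 1 + ln n rather than ln n
   because ln 1 = 0. *)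
Definition amortized_bound (R : realType) (s : state) (o : op) : R :=
  match o with
  | DeleteMin x | Delete _ x => (1 + ln (items_in s x)%:R)%R
  | _ => 1%R
  end.

(* [execution kd c os ts bs s]: the sequence of operations os, starting with no
   heaps, leads to s; ts and bs are the times and the claimed bounds of the
   successive operations. *)
Inductive execution {R : realType} (kd : kind) (c : R) :
    seq op -> seq nat -> seq R -> state -> Prop :=
| Execution_nil : execution kd c [::] [::] [::] [fmap]
| Execution_rcons os ts bs s o t s' :
    execution kd c os ts bs s -> step kd c s o t s' ->
    execution kd c (rcons os o) (rcons ts t)
      (rcons bs (amortized_bound R s o)) s'.

End HollowHeaps.

Arguments node {d} K I.
Arguments graph {d} K I.
Arguments heap {d} K I.
Arguments state {d} K I.
Arguments op {d} K I.

(* Main.v *)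
(* Idea.  Give each node w an optional virtual parent: the winner of the last
   ranked link that w lost, except that, in all three kinds, when decrease-key
   replaces u by v the virtual children of u of rank less than v.rank pass to v.
   Two-parent heaps, which move no arcs, thus behave virtually like the others.
   A node of rank r keeps virtual children of ranks r-1 and r-2, so the numbers
   of nodes of given ranks grow at least like Fibonacci numbers as the rank
   decreases, and ranks are O(log N).
   The potential counts the full nodes whose virtual parent is missing or hollow
   (3 each) and the hollow nodes with their incoming arcs (A each).  A ranked
   link makes its loser a virtual child of a full node and so pays for itself;
   destroying a hollow node is paid by the node and its arcs; decrease-key
   exposes at most two full nodes, and a deletion at most rank = O(log N).
   When N > c n, the number of hollow nodes is proportional to N, hence a large
   enough A, depending on c, pays for rebuilding. *)
Require Import Defs.
From mathcomp Require Import all_boot all_order all_algebra finmap.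
From mathcomp Require Import reals exp.
From mathcomp Require Import zify lra.
Set Implicit Arguments.
Unset Strict Implicit.
Unset Printing Implicit Defensive.
Local Open Scope fmap_scope.
Local Open Scope ring_scope.

(** * Virtual parents, ranks and the potential *)

Section Potential.
Local Open Scope fset_scope.
Local Open Scope nat_scope.
Context {d : Order.disp_t} {K : orderType d} {I : Type}.
Implicit Types (kd : kind) (g : graph K I) (u v w x p q i : nat) (vp : nat -> option nat).

Lemma in_domf g u : (u \in domf g) = isSome g.[? u].
Proof. by case: fndP. Qed.

Lemma fnd_upd g u f w :
  (upd g u f).[? w] = if w == u then omap f g.[? w] else g.[? w].
Proof.
rewrite /upd; case E: g.[? u] => [a|]; rewrite ?fnd_set; case: eqP => // ->;
by rewrite E.
Qed.

Lemma fnd_map_nodes f g w : (map_nodes f g).[? w] = omap (f w) g.[? w].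
Proof.
rewrite /map_nodes; case: fndP => /= kf; last by rewrite not_fnd.
by rewrite ffunE /= in_fnd.
Qed.

Lemma domf_upd g u f : domf (upd g u f) = domf g.
Proof. by apply/fsetP => w; rewrite !in_domf fnd_upd; case: eqP; case: g.[? w]. Qed.

Lemma full_domf g u : full g u -> u \in domf g.
Proof. by rewrite in_domf /full /item_of; case: g.[? u]. Qed.

Lemma is_rootP g u : reflect (u \in domf g /\ parents_of g u = [::]) (is_root g u).
Proof. by apply: (iffP andP) => -[-> /nilP ->]. Qed.

Definition two_parent kd := if kd is TwoParent then true else false.

Inductive reach g q : nat -> Prop :=
| reach_arc w : q \in parents_of g w -> reach g q w
| reach_step p w : reach g q p -> p \in parents_of g w -> reach g q w.

Lemma reach_parents g q w : reach g q w -> parents_of g w != [::].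
Proof. by case=> [w'|p w' _]; case: (parents_of g w'). Qed.

Lemma reach_trans g q p w : reach g q p -> reach g p w -> reach g q w.
Proof.
by move=> qp; elim=> [w' /reach_step|p' w' _ /reach_step]; apply.
Qed.

(** Every arc of a path from [q] starts at [q] or at a node that itself has a parent, so only such
    arcs have to survive. Destroying a root other than [q] loses none of them. *)
Lemma reach_mono g g' q w :
  (forall u p, p \in parents_of g u -> p = q \/ parents_of g p != [::] ->
     p \in parents_of g' u) ->
  reach g q w -> reach g' q w.
Proof.
move=> H; elim=> [w' qw|p w' qp IH pw]; first by apply: reach_arc; apply: H; auto.
by apply: reach_step IH _; apply: H => //; right; apply: reach_parents qp.
Qed.

(* [vp] is the virtual parent.  Outside the two-parent kind it is the actual
   parent through a ranked link.  In the two-parent kind it is only an ancestor,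
   because decrease-key leaves the arcs of the moved children in place.  A hollow
   node is only guaranteed to keep its virtual children of the two highest
   ranks. *)
Record vforest kd g vp : Prop := VForest {
  vf_parents : forall u,
    size (parents_of g u) <= (~~ full g u && two_parent kd).+1;
  vf_vp : forall w q, vp w = Some q ->
    [/\ w \in domf g, q \in domf g & rank_of g w < rank_of g q];
  vf_reach : forall w q, vp w = Some q ->
    if two_parent kd then reach g q w
    else parents_of g w = [:: q] /\ ranked_of g w;
  vf_inj : forall w1 w2 q, vp w1 = Some q -> vp w2 = Some q ->
    rank_of g w1 = rank_of g w2 -> w1 = w2;
  vf_rank : forall q i, i < rank_of g q -> full g q || (rank_of g q <= i.+2) ->
    exists2 w, vp w = Some q & rank_of g w = i;
  vf_ranked : ~~ two_parent kd -> forall u q, ranked_of g u ->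
    parents_of g u = [:: q] -> vp u = Some q
}.

Lemma vf_root kd g vp u : vforest kd g vp -> parents_of g u = [::] -> vp u = None.
Proof.
move=> gI pu; case E: (vp u) => [q|] //; have := vf_reach gI E.
by case: (two_parent kd) => [/reach_parents|[]]; rewrite pu.
Qed.

Lemma full_parents kd g vp u :
  vforest kd g vp -> full g u -> size (parents_of g u) <= 1.
Proof. by move=> gI fu; have := vf_parents gI u; rewrite fu. Qed.

(** * Growth of the rank counts and the rank bound *)

Definition at_rank g i := [seq u <- domf g | rank_of g u == i].

(* Each node of rank i+1 or i+2 has a virtual child of rank i, and distinct nodes
   have distinct virtual children. *)
Lemma at_rank_split kd g vp i : vforest kd g vp ->
  size (at_rank g i.+1) + size (at_rank g i.+2) <= size (at_rank g i).
Proof.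
move=> gI; rewrite -size_cat -(size_map (@Some nat)) -(size_map vp (at_rank g i)).
apply: uniq_leq_size.
  rewrite map_inj_uniq; last by move=> ? ? [].
  rewrite cat_uniq !filter_uniq ?fset_uniq //= andbT.
  apply/hasPn => u; rewrite !mem_filter => /andP[/eqP -> _].
  by rewrite eqn_leq ltnn.
move=> _ /mapP[u + ->].
rewrite mem_cat !mem_filter -andb_orl => /andP[ru ud].
have [w wu rw] : exists2 w, vp w = Some u & rank_of g w = i.
  by apply: (vf_rank gI); case/orP: ru => /eqP ->; rewrite ?leqnn ?leqnSn ?orbT.
 apply/mapP; exists w => //.
by rewrite mem_filter rw eqxx /=; case: (vf_vp gI wu).
Qed.

(** Two applications of [at_rank_split] show that the number of nodes of a given rank at least
    doubles whenever the rank drops by two. Starting from [u] itself, one can descend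
    [(rank_of g u)./2] times. *)
Lemma exp_rank_le kd g vp u : vforest kd g vp -> u \in domf g ->
  2 ^ (rank_of g u)./2 <= num_nodes g.
Proof.
move=> gI ud.
have dbl i : 2 * size (at_rank g i.+2) <= size (at_rank g i).
  by have := at_rank_split i gI; have := at_rank_split i.+1 gI; lia.
have pow j i : 2 ^ j * size (at_rank g (i + j.*2)) <= size (at_rank g i).
  elim: j i => [|j IH] i; first by rewrite addn0 mul1n.
  apply: leq_trans (dbl i); rewrite expnS -mulnA leq_mul2l /=.
  by apply: leq_trans (IH i.+2); rewrite doubleS !addnS !addSn.
have nz : 0 < size (at_rank g (rank_of g u)).
  by rewrite size_filter -has_count; apply/hasP; exists u.
(* The descent ends at rank 0 or 1, according to the parity of the rank of [u]. *)
have H := pow (rank_of g u)./2 (odd (rank_of g u)).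
rewrite odd_double_half in H.
apply: leq_trans (_ : size (at_rank g (odd (rank_of g u))) <= _).
  by apply: leq_trans H; rewrite leq_pmulr.
by rewrite size_filter /num_nodes; apply: leq_trans (count_size _ _) _.
Qed.

(** [exp_rank_le] bounds half the rank, rounded down, by the base-two logarithm of the number of
    nodes; the successor allows for an odd rank. *)
Definition rank_bound g := (trunc_log 2 (num_nodes g)).*2.+1.

Lemma rank_le kd g vp u : vforest kd g vp -> rank_of g u <= rank_bound g.
Proof.
move=> gI; case: (boolP (u \in domf g)) => [ud|]; last first.
  by rewrite in_domf /rank_of; case: g.[? u].
have := exp_rank_le gI ud => /(trunc_log_max (isT : 1 < 2)).
by rewrite /rank_bound; have := odd_double_half (rank_of g u); case: odd => /=; lia.
Qed.

Definition above g vp w := oapp (full g) false (vp w).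

(* The three units of a full node pay, when it becomes a root and then loses a
   ranked link, for detaching it from its parent, for storing it in the array and
   for the link. *)
Definition node_pot A g vp u :=
  if full g u then if above g vp u then 0 else 3
  else A * (size (parents_of g u)).+1.

Definition pot A g vp := \sum_(u <- domf g) node_pot A g vp u.

(** Virtual siblings have distinct ranks, all below the rank of [u]. The case [r = 0] bounds the
    nodes exposed by a deletion; [r = rank_of g u - 2] gives the at most two virtual children that
    decrease-key leaves behind. *)
Lemma fibre_count kd g vp u r : vforest kd g vp ->
  \sum_(w <- domf g) ((vp w == Some u) && (r <= rank_of g w))
    <= rank_of g u - r.
Proof.
move=> gI; set P := fun w => (vp w == Some u) && (r <= rank_of g w).
rewrite (eq_bigr (fun w => if P w then 1 else 0)); last first.
  by move=> w _; rewrite /P; case: (_ && _).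
rewrite -big_mkcond sum1_count -size_filter -(size_map (rank_of g)).
rewrite -(size_iota r (rank_of g u - r)); apply: uniq_leq_size.
  rewrite map_inj_in_uniq ?filter_uniq ?fset_uniq // => w1 w2.
  rewrite !mem_filter /P => /andP[/andP[/eqP e1 _] _] /andP[/andP[/eqP e2 _] _].
  exact: (vf_inj gI e1 e2).
move=> _ /mapP[w + ->]; rewrite mem_filter mem_iota /P.
by case/andP=> /andP[/eqP e -> ] _; case: (vf_vp gI e) => _ _; lia.
Qed.

End Potential.

(** * Links and destruction of hollow roots *)

Section Links.
Local Open Scope fset_scope.
Local Open Scope nat_scope.
Context {d : Order.disp_t} {K : orderType d} {I : Type}.
Implicit Types (kd : kind) (g : graph K I) (u v w x p q l i : nat).
Implicit Types (vp : nat -> option nat).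

Lemma full_rootP g u :
  reflect [/\ u \in domf g, parents_of g u = [::] & full g u] (full_root g u).
Proof. by apply: (iffP andP) => [[/is_rootP[]]|[? ? ?]]; split=> //; apply/is_rootP. Qed.

Lemma full_attach g w l b u : full (attach g w l b) u = full g u.
Proof. by rewrite /full /item_of fnd_upd; case: eqP => // ->; case: g.[? l]. Qed.

Lemma rank_attach g w l b u : rank_of (attach g w l b) u = rank_of g u.
Proof. by rewrite /rank_of fnd_upd; case: eqP => // ->; case: g.[? l]. Qed.

Lemma parents_attach g w l b u : l \in domf g ->
  parents_of (attach g w l b) u = if u == l then [:: w] else parents_of g u.
Proof.
by rewrite in_domf /parents_of fnd_upd; case: eqP => // ->; case: g.[? l].
Qed.

Lemma ranked_attach g w l b u : l \in domf g ->
  ranked_of (attach g w l b) u = if u == l then b else ranked_of g u.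
Proof.
by rewrite in_domf /ranked_of fnd_upd; case: eqP => // ->; case: g.[? l].
Qed.

Lemma reach_attach g w l b q u : l \in domf g -> parents_of g l = [::] ->
  reach g q u -> reach (attach g w l b) q u.
Proof.
move=> ld pl; apply: reach_mono => u' p; rewrite parents_attach //.
by case: (u' =P l) => // ->; rewrite pl.
Qed.

(** The loser was a root and so had no virtual parent, and an unranked link gives it none; hence the
    same [vp] still works. *)
Lemma vforest_attach kd g vp w l : vforest kd g vp -> can_link g w l ->
  vforest kd (attach g w l false) vp.
Proof.
move=> gI /and4P[/full_rootP[wd pw fw] /full_rootP[ld pl fl] wl _].
have vl := vf_root gI pl.
split.
- move=> u; rewrite full_attach parents_attach //; case: eqP => // _.
  exact: vf_parents gI u.
- by move=> u q /(vf_vp gI); rewrite !rank_attach domf_upd.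
- move=> u q uq; have := vf_reach gI uq; case: two_parent.
    exact: reach_attach.
  rewrite parents_attach // ranked_attach //; case: eqP => // ul.
  by rewrite ul vl in uq.
- by move=> w1 w2 q; rewrite !rank_attach; apply: vf_inj gI _ _ _.
- move=> q i; rewrite rank_attach full_attach => iq h.
  by have [u] := vf_rank gI iq h; exists u => //; rewrite rank_attach.
- move=> kd2 u q; rewrite parents_attach // ranked_attach //.
  by case: eqP => // _; apply: vf_ranked gI kd2 _ _.
Qed.

(** Only the loser gets a new parent, and it is full, so its potential depends on its virtual parent
    alone. *)
Lemma pot_attach A kd g vp w l : vforest kd g vp -> can_link g w l ->
  pot A (attach g w l false) vp = pot A g vp.
Proof.
move=> gI /and4P[/full_rootP[wd pw fw] /full_rootP[ld pl fl] wl _].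
rewrite /pot domf_upd; apply: eq_bigr => u _.
rewrite /node_pot full_attach parents_attach // /above.
have -> : oapp (full (attach g w l false)) false (vp u) = oapp (full g) false (vp u).
  by case: (vp u) => //= q; rewrite full_attach.
by case: eqP => // ->; rewrite fl.
Qed.

Definition full_roots g := \sum_(u <- domf g) full_root g u.

Lemma full_root_attach g w l b u : l \in domf g ->
  full_root (attach g w l b) u = (u != l) && full_root g u.
Proof.
move=> ld; rewrite /full_root /is_root domf_upd full_attach parents_attach //.
by case: eqP => //= _; rewrite andbF.
Qed.

Lemma full_roots_drop g g' l : full_root g l -> domf g' = domf g ->
  (forall u, full_root g' u = (u != l) && full_root g u) ->
  full_roots g = (full_roots g').+1.
Proof.
move=> lr dg H; have [ld _ _] := full_rootP _ _ lr.
rewrite /full_roots dg !(big_fsetD1 l ld) /= lr H eqxx /= add0n add1n; congr _.+1.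
by rewrite !big_seq; apply: eq_bigr => u; rewrite H !inE => /andP[->].
Qed.

Definition promote g w l : graph K I :=
  upd (attach g w l true) w
      (fun a => Node (item a) (key a) (rank a).+1 (parents a) (ranked a)).

Lemma domf_promote g w l : domf (promote g w l) = domf g.
Proof. by rewrite !domf_upd. Qed.

Lemma full_promote g w l u : full (promote g w l) u = full g u.
Proof.
rewrite -(full_attach g w l true) /full /item_of fnd_upd.
by case: eqP => // ->; case: (attach _ _ _ _).[? w].
Qed.

Lemma rank_promote g w l u : w \in domf g ->
  rank_of (promote g w l) u = rank_of g u + (u == w).
Proof.
move=> wd; rewrite -(rank_attach g w l true) /rank_of fnd_upd.
case: eqP => [->|_]; rewrite ?addn0 // addn1.
have : w \in domf (attach g w l true) by rewrite domf_upd.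
by rewrite in_domf; case: (attach _ _ _ _).[? w].
Qed.

Lemma parents_promote g w l u : l \in domf g ->
  parents_of (promote g w l) u = if u == l then [:: w] else parents_of g u.
Proof.
move=> ld; rewrite -(parents_attach w true u ld) /parents_of fnd_upd.
by case: eqP => // ->; case: (attach _ _ _ _).[? w].
Qed.

Lemma ranked_promote g w l u : l \in domf g ->
  ranked_of (promote g w l) u = (u == l) || ranked_of g u.
Proof.
move=> ld.
rewrite (_ : _ || _ = if u == l then true else ranked_of g u); last by case: eqP.
rewrite -(ranked_attach w true u ld) /ranked_of fnd_upd.
by case: (u =P w) => // ->; case: (attach _ _ _ _).[? w].
Qed.

Definition vp_promote vp w l u := if u == l then Some w else vp u.

(** The loser has the old rank of [w], the one rank missing among the virtual children of [w] once
    the rank of [w] has grown by one. The old virtual children have smaller ranks, so there is no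
    collision. *)
Lemma vforest_promote kd g vp w l : vforest kd g vp -> can_link g w l ->
  rank_of g w = rank_of g l -> vforest kd (promote g w l) (vp_promote vp w l).
Proof.
move=> gI /and4P[/full_rootP[wd pw fw] /full_rootP[ld pl fl] wl _] rwl.
have vl := vf_root gI pl; have vw := vf_root gI pw.
(* Only the rank of [w] changes, and [w], being a root, is no virtual child. *)
have rk u q : vp u = Some q -> rank_of (promote g w l) u = rank_of g u.
  by rewrite rank_promote //; case: eqP => [->|]; rewrite ?vw ?addn0.
have rl : rank_of (promote g w l) l = rank_of g w.
  by rewrite rank_promote // eq_sym (negbTE wl) addn0.
rewrite /vp_promote; split.
- move=> u; rewrite full_promote parents_promote //; case: eqP => // _.
  exact: vf_parents gI u.
- move=> u q; rewrite domf_promote; case: eqP => [-> [<-]|_ uq].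
    by rewrite rl rank_promote // eqxx addn1.
  have [-> -> r] := vf_vp gI uq; rewrite (rk _ _ uq) rank_promote //.
  by split => //; apply: leq_trans r (leq_addr _ _).
- move=> u q; rewrite parents_promote // ranked_promote //.
  case: eqP => [-> [<-]|ul uq].
    case: two_parent => //; apply: reach_arc.
    by rewrite parents_promote // eqxx inE.
  have := vf_reach gI uq; case: two_parent => //.
  apply: reach_mono => u' p; rewrite parents_promote //.
  by case: (u' =P l) => // ->; rewrite pl.
- move=> w1 w2 q; case: (w1 =P l) => [->|_]; case: (w2 =P l) => [->|_] //.
  + move=> [<-] w2q; rewrite rl (rk _ _ w2q) => e.
    by have [_ _] := vf_vp gI w2q; rewrite -e ltnn.
  + move=> w1q [e]; rewrite -{}e in w1q *; rewrite rl (rk _ _ w1q) => e.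
    by have [_ _] := vf_vp gI w1q; rewrite e ltnn.
  + by move=> w1q w2q; rewrite (rk _ _ w1q) (rk _ _ w2q); apply: (vf_inj gI w1q w2q).
- move=> q i; rewrite full_promote rank_promote //.
  case: (q =P w) => [->|qw]; rewrite ?addn0 ?addn1 ?fw /=; last first.
    move=> iq h; have [u uq ru] := vf_rank gI iq h; exists u; last by rewrite (rk _ _ uq).
    by case: eqP => // ul; rewrite ul vl in uq.
  rewrite ltnS leq_eqVlt => /orP[/eqP -> _|iw _]; first by exists l; rewrite ?eqxx.
  have [||u uq ru] := @vf_rank _ _ _ _ _ _ gI w i; rewrite ?fw //.
  exists u; last by rewrite (rk _ _ uq).
  by case: eqP => // ul; rewrite ul vl in uq.
- move=> kd2 u q; rewrite parents_promote // ranked_promote //.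
  case: eqP => [_ _ [->] //|_ /=]; exact: vf_ranked gI kd2 _ _.
Qed.

(** The loser passes from having no virtual parent to having a full one, which releases exactly its
    3 units. *)
Lemma pot_promote A kd g vp w l : vforest kd g vp -> can_link g w l ->
  pot A g vp = 3 + pot A (promote g w l) (vp_promote vp w l).
Proof.
move=> gI /and4P[/full_rootP[wd pw fw] /full_rootP[ld pl fl] wl _].
have vl := vf_root gI pl.
rewrite /pot domf_promote !(big_fsetD1 l ld) /= /node_pot full_promote fl.
rewrite /above vl /= /vp_promote eqxx /= full_promote fw add0n; congr (_ + _).
rewrite !big_seq; apply: eq_bigr => u; rewrite !inE => /andP[ul _].
rewrite full_promote parents_promote // (negbTE ul).
by case: (vp u) => //= q; rewrite full_promote.
Qed.

Lemma full_root_promote g w l u : l \in domf g ->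
  full_root (promote g w l) u = (u != l) && full_root g u.
Proof.
move=> ld; rewrite /full_root /is_root domf_promote full_promote parents_promote //.
by case: eqP => //= _; rewrite andbF.
Qed.

Definition remove_node g x : graph K I :=
  map_nodes (fun _ a => set_parents [seq p <- parents a | p != x] a) g.[~ x].

Lemma fnd_remove g x u : (remove_node g x).[? u] =
  if u == x then None
  else omap (fun a => set_parents [seq p <- parents a | p != x] a) g.[? u].
Proof. by rewrite fnd_map_nodes fnd_rem1; case: eqP. Qed.

Lemma domf_remove g x : domf (remove_node g x) = domf g `\ x.
Proof.
apply/fsetP => u; rewrite in_domf fnd_remove !inE in_domf.
by case: eqP => //=; case: g.[? u].
Qed.

Lemma full_remove g x u : full (remove_node g x) u = (u != x) && full g u.
Proof.
by rewrite /full /item_of fnd_remove; case: eqP => //= _; case: g.[? u].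
Qed.

Lemma parents_remove g x u : parents_of (remove_node g x) u =
  if u == x then [::] else [seq p <- parents_of g u | p != x].
Proof.
by rewrite /parents_of fnd_remove; case: eqP => //= _; case: g.[? u].
Qed.

Lemma rank_remove g x u : u != x -> rank_of (remove_node g x) u = rank_of g u.
Proof.
by rewrite /rank_of fnd_remove; case: eqP => //= _; case: g.[? u].
Qed.

Lemma ranked_remove g x u : u != x -> ranked_of (remove_node g x) u = ranked_of g u.
Proof.
by rewrite /ranked_of fnd_remove; case: eqP => //= _; case: g.[? u].
Qed.

Definition vp_remove vp x u := if vp u == Some x then None else vp u.

Lemma vp_removeP vp x u q :
  vp_remove vp x u = Some q <-> vp u = Some q /\ q != x.
Proof.
rewrite /vp_remove; case: eqP => [->|ne]; split=> //.
- by case=> [[->]]; rewrite eqxx.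
- by move=> e; split=> //; apply/eqP => qx; rewrite -qx in ne.
- by case.
Qed.

(** The destroyed node is a root, hence no virtual child, so no remaining node misses a virtual
    child. Its own virtual children just lose their virtual parent. *)
Lemma vforest_remove kd g vp x : vforest kd g vp -> is_root g x -> ~~ full g x ->
  vforest kd (remove_node g x) (vp_remove vp x).
Proof.
move=> gI /is_rootP[xd px] fx; have vx := vf_root gI px.
have nx u q : vp u = Some q -> u != x by apply: contra_eq_neq => ->; rewrite vx.
split.
- move=> u; rewrite full_remove parents_remove; case: eqP => //= _.
  by rewrite size_filter; apply: leq_trans (count_size _ _) (vf_parents gI u).
- move=> u q /vp_removeP[uq qx]; have [ud qd r] := vf_vp gI uq.
  by rewrite domf_remove !inE qx ud qd (nx _ _ uq) !rank_remove // (nx _ _ uq).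
- move=> u q /vp_removeP[uq qx]; have := vf_reach gI uq.
  have ux := nx _ _ uq; case: two_parent.
    (* A path from [q] cannot pass through the root [x], since [q] differs from [x]. *)
    apply: reach_mono => u' p pu' h; rewrite parents_remove.
    case: eqP => [e|_]; first by rewrite e px in pu'.
    rewrite mem_filter pu' andbT; case: h => [-> //|].
    by apply: contraNneq => ->; rewrite px.
  by rewrite parents_remove ranked_remove // (negbTE ux) => -[-> ->] /=; rewrite qx.
- move=> w1 w2 q /vp_removeP[w1q _] /vp_removeP[w2q _].
  rewrite !rank_remove ?(nx _ _ w1q) ?(nx _ _ w2q) //.
  exact: (vf_inj gI w1q w2q).
- move=> q i; have [->|qx] := eqVneq q x.
    by rewrite {1}/rank_of fnd_remove eqxx.
  rewrite full_remove rank_remove // qx => iq h.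
  have [u uq ru] := vf_rank gI iq h; exists u; first exact/vp_removeP.
  by rewrite rank_remove // (nx _ _ uq).
- move=> kd2 u q; rewrite parents_remove; case: eqP => // /eqP ux.
  rewrite ranked_remove // => ru pu; apply/vp_removeP.
  have := vf_parents gI u; rewrite (negbTE kd2) andbF => pu1.
  have qx : q != x.
    have : q \in [seq p <- parents_of g u | p != x] by rewrite pu inE.
    by rewrite mem_filter => /andP[].
  split=> //; apply: (vf_ranked gI kd2 ru).
  move: pu1 pu; case: (parents_of g u) => [|p [|]] //= _.
  by case: ifP => // _ [->].
Qed.

Lemma sum_fset (X : {fset nat}) (P : pred nat) :
  #|` [fset u in X | P u]| = \sum_(u <- X) P u.
Proof.
rewrite card_fset_sum1 big_fset /= big_mkcond.
by apply: eq_bigr => u _; case: (P u).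
Qed.
End Links.

(** * Deletions *)

Section Deletion.
Local Open Scope fset_scope.
Local Open Scope nat_scope.
Context {d : Order.disp_t} {K : orderType d} {I : Type}.
Implicit Types (kd : kind) (g : graph K I) (u v w x p q l i t : nat).
Implicit Types (vp : nat -> option nat).

(* Full children of the destroyed root become roots: detaching them is charged to
   the increase of [full_roots], not to the potential. *)
Lemma pot_remove A kd g vp x : 0 < A -> vforest kd g vp ->
  is_root g x -> ~~ full g x ->
  1 + #|` children g x| + full_roots g + pot A (remove_node g x) (vp_remove vp x)
    <= pot A g vp + full_roots (remove_node g x).
Proof.
move=> A0 gI xr fx; have /is_rootP[xd px] := xr.
rewrite /children sum_fset /full_roots /pot domf_remove !(big_fsetD1 x xd) /=.
rewrite px /= /full_root xr (negbTE fx) /= !add0n {2}/node_pot (negbTE fx) px /=.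
set X := domf g `\ x; rewrite -addnA -big_split -addnA -big_split -/X /=.
rewrite -addnA -big_split muln1 /=; apply: leq_add => //.
rewrite !big_seq; apply: leq_sum => u; rewrite !inE => /andP[ux ud].
rewrite /is_root domf_remove !inE ux ud full_remove ux /=.
rewrite parents_remove (negbTE ux) /node_pot full_remove ux /= parents_remove (negbTE ux).
(* A hollow child loses at least one incoming arc, and the [A] released pays for detaching it. *)
have := vf_parents gI u; case: (boolP (full g u)) => fu /=; last first.
  rewrite !andbF !add0n addn0 => _; rewrite size_filter.
  rewrite -(count_predC (pred1 x) (parents_of g u)) -[count (pred1 x) _]/(count_mem x _).
  rewrite (_ : count (predC _) _ = count (fun p => p != x) (parents_of g u)) //.
  rewrite -has_pred1 has_count.
  by case: (count (pred1 x) _) => [|n] /=; nia.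
move=> pu1.
(* A full node holds 3 units both under a hollow virtual parent and under none, so losing the hollow
   [x] changes nothing. *)
have -> : above (remove_node g x) (vp_remove vp x) u = above g vp u.
  rewrite /above /vp_remove; case: eqP => [->|]; first by rewrite /= (negbTE fx).
  case: (vp u) => //= q qx; rewrite full_remove.
  by have -> : q != x by apply/eqP => e; case: qx; rewrite e.
rewrite !andbT addnA [leqRHS]addnC leq_add2r.
(* A full child of [x] has no other parent, so it becomes a full root. *)
move: pu1; case: (parents_of g u) => [|p [|]] //= _.
by rewrite inE eq_sym; case: eqP.
Qed.

Lemma iterate_destroy A kd g t g1 vp : 0 < A -> vforest kd g vp ->
  iterate (@destroy_hollow_root d K I) g t g1 ->
  exists vp1, [/\ vforest kd g1 vp1,
    t + full_roots g + pot A g1 vp1 <= pot A g vp + full_roots g1 &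
    domf g1 `<=` domf g].
Proof.
move=> A0 gI H; elim: H vp gI => {g t g1} [g|g t g1 t1 g2 [x xr fx] _ IH] vp gI.
  by exists vp; split=> //; rewrite add0n addnC.
have [vp1 [I1 le1 sub1]] := IH _ (vforest_remove gI xr fx).
exists vp1; split=> //; last first.
  by apply: fsubset_trans sub1 _; rewrite domf_remove fsubD1set.
have := pot_remove A0 gI xr fx; rewrite /remove_node in le1 *; lia.
Qed.

Lemma iterate_ranked A kd g t g1 vp : vforest kd g vp ->
  iterate (@ranked_link d K I) g t g1 ->
  exists vp1, [/\ vforest kd g1 vp1,
    pot A g vp = 3 * t + pot A g1 vp1, full_roots g = t + full_roots g1 &
    domf g1 = domf g].
Proof.
move=> gI H; elim: H vp gI => {g t g1} [g|g t g1 t1 g2 [w l wl rwl] _ IH] vp gI.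
  by exists vp; split.
have [vp1 [I1 le1 fr1 dom1]] := IH _ (vforest_promote gI wl rwl).
have /and4P[_ lr _ _] := wl; have [ld _ _] := full_rootP _ _ lr.
exists vp1; split=> //; last by rewrite dom1 domf_promote.
  by rewrite (pot_promote A gI wl) /promote le1; lia.
rewrite (full_roots_drop lr (domf_promote g w l)) ?fr1 // => u.
exact: full_root_promote.
Qed.

Lemma iterate_unranked A kd g t g1 vp : vforest kd g vp ->
  iterate (@unranked_link d K I) g t g1 ->
  [/\ vforest kd g1 vp, pot A g vp = pot A g1 vp,
    full_roots g = t + full_roots g1, domf g1 = domf g &
    forall u, full g1 u = full g u].
Proof.
move=> gI H; elim: H vp gI => {g t g1} [g|g t g1 t1 g2 [w l wl] _ IH] vp gI //.
have [I1 le1 fr1 dom1 f1] := IH _ (vforest_attach gI wl).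
have /and4P[_ lr _ _] := wl; have [ld _ _] := full_rootP _ _ lr.
have dg : domf (attach g w l false) = domf g by rewrite domf_upd.
split=> //.
- by rewrite -le1 (pot_attach A gI wl).
- rewrite (full_roots_drop lr dg) ?fr1 // => u; exact: full_root_attach.
- by rewrite dom1.
- by move=> u; rewrite f1 full_attach.
Qed.

(** Two full roots of equal rank could be linked, one way or the other since keys are totally
    ordered. So the full roots have distinct ranks between 0 and [rank_bound g]. *)
Lemma full_roots_le kd g vp : vforest kd g vp ->
  ~ (exists t g1, ranked_link g t g1) -> full_roots g <= (rank_bound g).+1.
Proof.
move=> gI stuck.
rewrite /full_roots -sum_fset -(size_map (rank_of g)) -[(_.+1)](size_iota 0).
apply: uniq_leq_size; last first.
  by move=> _ /mapP[u _ ->]; rewrite mem_iota ltnS (rank_le u gI).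
rewrite map_inj_in_uniq ?fset_uniq // => u w; rewrite !inE => /andP[ud ur] /andP[wd wr] e.
apply/eqP/negPn/negP => uw; apply: stuck.
wlog le : u w ud wd ur wr e uw / key_le g u w.
  move=> W; have [|wu] : key_le g u w \/ key_le g w u.
  - move: ud wd; rewrite !in_domf /key_le.
    case: g.[? u] g.[? w] => [a|] [b|] // _ _.
    by case/orP: (Order.TotalTheory.le_total (key a) (key b)); [left|right].
  - exact: (W u w).
  - by apply: (W w u) => //; rewrite eq_sym.
by exists 1, (promote g u w); apply: Ranked_link => //; rewrite /can_link ur wr uw.
Qed.

Lemma rank_bound_sub g g' : domf g' `<=` domf g -> rank_bound g' <= rank_bound g.
Proof.
by move=> /fsubset_leq_card le; rewrite ltnS leq_double leq_trunc_log.
Qed.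

Lemma array_size_le kd g vp : vforest kd g vp -> array_size g <= (rank_bound g).+1.
Proof.
by move=> gI; rewrite ltnS; apply/bigmax_leqP_seq => u _ _; apply: rank_le gI.
Qed.

Lemma card_roots g : ~ (exists t g1, destroy_hollow_root g t g1) ->
  #|` root_nodes g| = full_roots g.
Proof.
move=> stuck; rewrite sum_fset /full_roots; apply: eq_bigr => u _.
rewrite /full_root; case: (boolP (is_root g u)) => //= ur.
case: (boolP (full g u)) => // fu; case: stuck.
by exists (1 + #|` children g u|), (remove_node g u); apply: Destroy.
Qed.

(** Let f1 and f2 be the numbers of full roots before and after the ranked links. Beyond the
    potential it releases, destruction costs at most f1; filling the array costs f1 again, and f1 =
    t2 + f2. The 3 units released by each ranked link pay for the link and for all but 2 f2 of this.
    With at most f2 unranked links and the array scan, four terms of at most [(rank_bound g).+1]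
    remain. *)
Lemma restore_amortized A kd g vp t g' : 0 < A -> vforest kd g vp ->
  restore kd g t g' ->
  exists vp', [/\ vforest kd g' vp',
    t + pot A g' vp' <= pot A g vp + 4 * (rank_bound g).+1 &
    domf g' `<=` domf g].
Proof.
move=> A0 gI [g1 [g2 [t1 [t2 [t3 [[D1 S1] [D2 S2] D3 ->]]]]]].
have [vp1 [I1 le1 sub1]] := iterate_destroy A0 gI D1.
have [vp2 [I2 le2 fr2 dom2]] := iterate_ranked A I1 D2.
have fr := full_roots_le I2 S2; have ar := array_size_le I2.
have rb : rank_bound g2 <= rank_bound g by apply: rank_bound_sub; rewrite dom2.
rewrite (card_roots S1); exists vp2.
suff [I3 e3 t3le dom3] : [/\ vforest kd g' vp2, pot A g' vp2 = pot A g2 vp2,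
    t3 <= full_roots g2 & domf g' = domf g2].
  by split=> //; [lia | rewrite dom3 dom2].
move: D3; case: (kd) I2 => I2 D3; try by case: D3 => -> ->.
all: have [I3 e3 fr3 dom3 _] := iterate_unranked A I2 D3.1; split=> //; lia.
Qed.

Definition hollow_node g u := upd g u (set_item None).

Lemma full_hollow g u w : full (hollow_node g u) w = (w != u) && full g w.
Proof. by rewrite /full /item_of fnd_upd; case: eqP => //= _; case: g.[? w]. Qed.

Lemma rank_hollow g u w : rank_of (hollow_node g u) w = rank_of g w.
Proof. by rewrite /rank_of fnd_upd; case: eqP => //= _; case: g.[? w]. Qed.

Lemma parents_hollow g u w : parents_of (hollow_node g u) w = parents_of g w.
Proof. by rewrite /parents_of fnd_upd; case: eqP => //= _; case: g.[? w]. Qed.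

Lemma ranked_hollow g u w : ranked_of (hollow_node g u) w = ranked_of g w.
Proof. by rewrite /ranked_of fnd_upd; case: eqP => //= _; case: g.[? w]. Qed.

(** The two conditions of [vforest] that mention fullness ask no more of a hollow node than of a
    full one. *)
Lemma vforest_hollow kd g vp u : vforest kd g vp -> full g u ->
  vforest kd (hollow_node g u) vp.
Proof.
move=> gI fu; split.
- move=> w; rewrite full_hollow parents_hollow.
  by have := vf_parents gI w; case: eqP => [->|//]; rewrite fu => /leq_trans; apply.
- by move=> w q /(vf_vp gI); rewrite !rank_hollow domf_upd.
- move=> w q /(vf_reach gI); rewrite parents_hollow ranked_hollow.
  by case: two_parent => //; apply: reach_mono => ? ?; rewrite parents_hollow.
- by move=> w1 w2 q; rewrite !rank_hollow; apply: vf_inj gI _ _ _.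
- move=> q i; rewrite full_hollow rank_hollow => iq h.
  have [|w wq rw] := vf_rank gI iq; last by exists w; rewrite ?rank_hollow.
  by case/orP: h => [/andP[_ ->]|->]; rewrite ?orbT.
- by move=> kd2 w q; rewrite parents_hollow ranked_hollow; apply: vf_ranked gI kd2 _ _.
Qed.

Lemma sum_pred1 (X : {fset nat}) u : \sum_(w <- X) (w == u) <= 1.
Proof.
rewrite -sum_fset; apply: leq_trans (_ : #|` [fset u]| <= 1); last by rewrite cardfs1.
by apply: fsubset_leq_card; apply/fsubsetP => w; rewrite !inE => /andP[].
Qed.

(** A full node has at most one parent, so once hollow it holds at most [2 * A]. Each of its at most
    [rank_of g u] virtual children may lose a full virtual parent and then needs 3 units. *)
Lemma pot_hollow A kd g vp u : vforest kd g vp -> full g u ->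
  pot A (hollow_node g u) vp <= pot A g vp + 2 * A + 3 * rank_of g u.
Proof.
move=> gI fu; rewrite /pot domf_upd.
have h1 := sum_pred1 (domf g) u; have h2 := fibre_count u 0 gI.
apply: leq_trans (_ : \sum_(w <- domf g) (node_pot A g vp w +
  (w == u) * (2 * A) + ((vp w == Some u) && (0 <= rank_of g w)) * 3) <= _); last first.
  rewrite !big_split -!big_distrl /= -addnA -[leqRHS]addnA leq_add2l.
  rewrite subn0 in h2.
  apply: leq_add; last by rewrite mulnC leq_mul2l.
  by rewrite -[leqRHS]mul1n leq_mul2r h1 orbT.
apply: leq_sum => w _; rewrite /node_pot full_hollow parents_hollow /above.
have [->|wu] := eqVneq w u; rewrite /= ?andbT.
  by rewrite fu; have := full_parents gI fu; rewrite mul1n; nia.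
case: (full g w); last by rewrite -addnA leq_addr.
case: (vp w) => [q|] //=; rewrite full_hollow.
have [->|qu] := eqVneq q u; first by rewrite eqxx; case: ifP.
by case: (full g q).
Qed.

Lemma delete_node_amortized A kd u (h : heap K I) t h' vp : 0 < A ->
  vforest kd (nodes h) vp -> delete_node kd u h t h' ->
  exists vp', [/\ vforest kd (nodes h') vp',
    t + pot A (nodes h') vp' <=
      pot A (nodes h) vp + (2 * A + 8) * (rank_bound (nodes h)).+1 &
    domf (nodes h') `<=` domf (nodes h)].
Proof.
move=> A0 gI; have rl := rank_le u gI; case=> {t h'} [fu _|t g m fu _ R _] /=.
  exists vp; split; [exact: vforest_hollow| |by rewrite domf_upd].
  have := pot_hollow A gI fu; rewrite /hollow_node; nia.
have [vp' [I' le' sub']] := restore_amortized A0 (vforest_hollow gI fu) R.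
exists vp'; split=> //; last by apply: fsubset_trans sub' _; rewrite domf_upd.
have : rank_bound (hollow_node (nodes h) u) <= rank_bound (nodes h).
  by apply: rank_bound_sub; rewrite domf_upd.
have := pot_hollow A gI fu; nia.
Qed.
End Deletion.

(** * Decrease-key *)

Section DecreaseKey.
Local Open Scope fset_scope.
Local Open Scope nat_scope.
Context {d : Order.disp_t} {K : orderType d} {I : Type}.
Implicit Types (kd : kind) (g : graph K I) (u v w x p q l i t : nat).
Implicit Types (vp : nat -> option nat).

Lemma join_amortized A kd g a b g' m vp : vforest kd g vp -> join kd g a b g' m ->
  [/\ vforest kd g' vp, pot A g' vp = pot A g vp & domf g' = domf g].
Proof.
move=> gI; case=> [m0 _ _ //|w l _ _ wl]; split; last by rewrite domf_upd.
  exact: vforest_attach.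
exact: pot_attach gI wl.
Qed.

Definition move_arc u v : seq nat -> seq nat :=
  map (fun p => if p == u then v else p).

(* [g1] is [g] after the arcs have been treated and before the final join; [S] is
   the set of children physically moved from [u] to [v], irrelevant in the
   two-parent kind. *)
Record decreased kd g u v (S : pred nat) g1 : Prop := Decreased {
  dec_new : v \notin domf g;
  dec_full : full g u;
  dec_domf : domf g1 = v |` domf g;
  dec_full_new : full g1 v;
  dec_full_old : forall w, w != v -> full g1 w = (w != u) && full g w;
  dec_rank_new : rank_of g1 v = rank_of g u - 2;
  dec_rank_old : forall w, w != v -> rank_of g1 w = rank_of g w;
  dec_ranked_old : forall w, w != v -> ranked_of g1 w = ranked_of g w;
  dec_parents_new : parents_of g1 v = [::];
  dec_parents_old : forall w, w != v -> parents_of g1 w =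
    if two_parent kd then
      if w == u then rcons (parents_of g w) v else parents_of g w
    else if S w then move_arc u v (parents_of g w) else parents_of g w;
  dec_moved : ~~ two_parent kd -> forall w, S w -> u \in parents_of g w;
  dec_moved_rank : ~~ two_parent kd -> forall w,
    ranked_of g w -> u \in parents_of g w -> S w = (rank_of g w < rank_of g u - 2)
}.

(** The subtraction is truncated, so the threshold is the rank of the new node. One rule serves all
    kinds, although in the two-parent kind the arcs stay where they are. *)
Definition vp_decrease g vp u v w :=
  if (vp w == Some u) && (rank_of g w < rank_of g u - 2) then Some v else vp w.

Lemma vp_decreaseP g vp u v w q : vp_decrease g vp u v w = Some q <->
  [/\ q = v, vp w = Some u & rank_of g w < rank_of g u - 2] \/
  vp w = Some q /\ ~~ ((q == u) && (rank_of g w < rank_of g u - 2)).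
Proof.
rewrite /vp_decrease; split.
  case: ifP => [/andP[/eqP wu r] [<-]|h wq]; [by left|right; split=> //].
  by apply/negP => /andP[/eqP e r]; rewrite wq e eqxx r in h.
case=> [[-> -> ->]|[-> h]]; first by rewrite eqxx.
by case: ifP => // /andP[/eqP[e] r]; rewrite e eqxx r in h.
Qed.

(** With r the rank of [u], the new node has rank r - 2 and receives the virtual children of smaller
    rank. The hollow [u] keeps those of ranks r - 1 and r - 2, which is all that is required of
    it. *)
Lemma vforest_decrease kd g vp u v S g1 : vforest kd g vp ->
  decreased kd g u v S g1 -> vforest kd g1 (vp_decrease g vp u v).
Proof.
move=> gI [vd fu dom fv fo rv ro kro pv po S1 S2].
have ud := full_domf fu.
have uv : u != v by apply: contraNneq vd => <-.
have nv w q : vp w = Some q -> w != v.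
  by case/(vf_vp gI) => wd _ _; apply: contraNneq vd => <-.
have qv w q : vp w = Some q -> q != v.
  by case/(vf_vp gI) => _ qd _; apply: contraNneq vd => <-.
have pu1 : size (parents_of g u) <= 1 := full_parents gI fu.
split.
- move=> w; have [->|wv] := eqVneq w v; first by rewrite pv.
  rewrite po // fo //; have := vf_parents gI w; move: S1 S2.
  case: (two_parent kd) => S1 S2; rewrite ?andbF ?andbT.
    by have [->|_] := eqVneq w u; rewrite //= size_rcons.
  by case: (S w); rewrite // size_map.
- move=> w q /vp_decreaseP[[-> wu r]|[wq _]].
    have [wd _ _] := vf_vp gI wu; rewrite dom !inE eqxx wd orbT rv ro //.
    exact: nv wu.
  have [wd qd r] := vf_vp gI wq; rewrite dom !inE wd qd !orbT !ro //.
    exact: qv wq.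
  exact: nv wq.
- move=> w q wq.
  have wv : w != v by case/vp_decreaseP: wq => [[_ /nv]|[/nv]].
  case: (boolP (two_parent kd)) => kd2; last first.
    (* Outside the two-parent kind a ranked child is physically moved exactly when it passes
       virtually, so virtual parents remain actual parents. *)
    rewrite po // (negbTE kd2) kro //; case/vp_decreaseP: wq => [[-> wu r]|[wq h]].
      have := vf_reach gI wu; rewrite (negbTE kd2) => -[pw rw].
      by rewrite S2 // pw ?inE ?eqxx // r /= eqxx.
    have := vf_reach gI wq; rewrite (negbTE kd2) => -[pw rw].
    case: ifP => // Sw; have uw := S1 kd2 _ Sw; rewrite S2 // in Sw.
    by move: uw h; rewrite Sw pw inE => /eqP ->; rewrite eqxx.
  have mono q' w' : reach g q' w' -> reach g1 q' w'.
    apply: reach_mono => w1 p pw _.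
    have w1v : w1 != v.
      apply: contraTneq pw => ->; move: vd; rewrite in_domf /parents_of.
      by case: g.[? v].
    by rewrite po // kd2; case: eqP => // _; rewrite mem_rcons inE pw orbT.
  case/vp_decreaseP: wq => [[-> wu _]|[wq _]]; last first.
    by have := vf_reach gI wq; rewrite kd2; apply: mono.
  (* The new arc from [v] to [u] extends the path from [u] to [w]. *)
  have := vf_reach gI wu; rewrite kd2 => /mono; apply: reach_trans.
  by apply: reach_arc; rewrite po // kd2 eqxx mem_rcons inE eqxx.
- move=> w1 w2 q w1q w2q.
  have [w1v w2v] : w1 != v /\ w2 != v.
    by split; [case/vp_decreaseP: w1q => [[_ /nv]|[/nv]]
              |case/vp_decreaseP: w2q => [[_ /nv]|[/nv]]].
  rewrite !ro //.
  case/vp_decreaseP: w1q => [[e1 w1u _]|[w1q _]];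
  case/vp_decreaseP: w2q => [[e2 w2u _]|[w2q _]].
  + exact: (vf_inj gI w1u w2u).
  + by have := qv _ _ w2q; rewrite e1 eqxx.
  + by have := qv _ _ w1q; rewrite e2 eqxx.
  + exact: (vf_inj gI w1q w2q).
- move=> q i; have [->|qv'] := eqVneq q v.
    rewrite rv => iv _; have [||w wu rw] := @vf_rank _ _ _ _ _ _ gI u i; rewrite ?fu //.
      lia.
    exists w; last by rewrite ro // (nv _ _ wu).
    by apply/vp_decreaseP; left; rewrite rw.
  rewrite ro // fo // => iq h; have [|w wq rw] := vf_rank gI iq.
    by case/orP: h => [/andP[_ ->]|->]; rewrite ?orbT.
  exists w; last by rewrite ro // (nv _ _ wq).
  apply/vp_decreaseP; right; split=> //; rewrite rw.
  by apply/negP => /andP[/eqP e]; move: h; rewrite e eqxx /=; lia.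
- move=> kd2 w q; have [->|wv] := eqVneq w v; first by rewrite pv.
  rewrite kro // po // (negbTE kd2) => rw pw; apply/vp_decreaseP.
  move: pw; case: ifP => Sw pw.
    have uw := S1 kd2 _ Sw; have := S2 kd2 _ rw uw; rewrite Sw => /esym r.
    have := vf_parents gI w; rewrite (negbTE kd2) andbF.
    move: uw pw; case e : (parents_of g w) => [|p [|]] //=.
    rewrite inE => /eqP e'; rewrite -e' eqxx in e *; case=> [<-] _; left; split=> //.
    exact: vf_ranked gI kd2 _ _ rw e.
  right; split; first exact: vf_ranked gI kd2 _ _ rw pw.
  apply/negP => /andP[/eqP e r].
  by rewrite S2 // ?r // pw e inE eqxx in Sw.
Qed.

(** The new node has no virtual parent and holds 3. The hollow [u] holds at most [3 * A]: for
    itself, for at most one old parent and, in the two-parent kind, for the arc from [v]. The at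
    most two virtual children left with [u] account for the other 6. *)
Lemma pot_decrease A kd g vp u v S g1 : vforest kd g vp ->
  decreased kd g u v S g1 ->
  pot A g1 (vp_decrease g vp u v) <= pot A g vp + 3 * A + 9.
Proof.
move=> gI [vd fu dom fv fo rv ro kro pv po S1 S2].
rewrite /pot dom big_fsetU1 //=.
have -> : node_pot A g1 (vp_decrease g vp u v) v = 3.
  rewrite /node_pot fv /above.
  case e : (vp_decrease _ _ _ _ _) => [q|] //; case/vp_decreaseP: e.
    by case=> _ /(vf_vp gI)[]; rewrite (negbTE vd).
  by case=> /(vf_vp gI)[]; rewrite (negbTE vd).
have h1 := sum_pred1 (domf g) u; have h2 := fibre_count u (rank_of g u - 2) gI.
suff : \sum_(w <- domf g) node_pot A g1 (vp_decrease g vp u v) w <=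
    \sum_(w <- domf g) (node_pot A g vp w + (w == u) * (3 * A) +
      ((vp w == Some u) && (rank_of g u - 2 <= rank_of g w)) * 3).
  rewrite !big_split -!big_distrl /=.
  set s1 := \sum_(i <- _) (i == u) in h1 *; set s2 := \sum_(i <- _) (_ && _) in h2 *.
  have : s1 * (3 * A) <= 1 * (3 * A) by rewrite leq_mul2r h1 orbT.
  move: s1 s2 h1 h2 => s1 s2; lia.
rewrite !big_seq; apply: leq_sum => w wd.
have wv : w != v by apply: contraNneq vd => <-.
rewrite /node_pot fo // po //; have [->|wu] := eqVneq w u; rewrite /= ?andbT.
  have := full_parents gI fu; rewrite fu mul1n.
  case: two_parent => h; first by rewrite size_rcons; nia.
  by case: (S u); rewrite ?size_map; nia.
case: (full g w); last first.
  by case: two_parent => //; case: (S w); rewrite ?size_map -addnA leq_addr.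
rewrite /above /vp_decrease addn0; case: (vp w) => [q|] //=.
have [e|qu] := eqVneq q u.
  (* A virtual child that passes from [u] to [v] still has a full virtual parent. *)
  rewrite e eqxx /=; case: ltnP => r /=; first by rewrite fv.
  by case: ifP; case: ifP.
rewrite (_ : (Some q == Some u) = false) /=; last first.
  by apply/eqP => -[e]; rewrite e eqxx in qu.
case: (boolP (full g q)) => fq; last by case: ifP.
have qv : q != v by apply: contraNneq vd => <-; apply: full_domf.
by rewrite fo // qu fq.
Qed.
End DecreaseKey.

(** * Graph updates made by decrease-key and its amortized cost *)

Section HeapOperations.
Local Open Scope fset_scope.
Local Open Scope nat_scope.
Context {d : Order.disp_t} {K : orderType d} {I : Type}.
Implicit Types (kd : kind) (g : graph K I) (h : heap K I) (u v w x p q l i t : nat).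
Implicit Types (vp : nat -> option nat).

Section SetKey.
Variables (g : graph K I) (u : nat) (k : K).
Let g' := upd g u (set_key k).

Lemma full_set_key w : full g' w = full g w.
Proof. by rewrite /full /item_of fnd_upd; case: eqP => //= _; case: g.[? w]. Qed.

Lemma rank_set_key w : rank_of g' w = rank_of g w.
Proof. by rewrite /rank_of fnd_upd; case: eqP => //= _; case: g.[? w]. Qed.

Lemma parents_set_key w : parents_of g' w = parents_of g w.
Proof. by rewrite /parents_of fnd_upd; case: eqP => //= _; case: g.[? w]. Qed.

Lemma ranked_set_key w : ranked_of g' w = ranked_of g w.
Proof. by rewrite /ranked_of fnd_upd; case: eqP => //= _; case: g.[? w]. Qed.

Lemma vforest_set_key kd vp : vforest kd g vp -> vforest kd g' vp.
Proof.
move=> gI; split.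
- by move=> w; rewrite full_set_key parents_set_key; apply: vf_parents gI w.
- by move=> w q /(vf_vp gI); rewrite !rank_set_key domf_upd.
- move=> w q /(vf_reach gI); rewrite parents_set_key ranked_set_key.
  by case: two_parent => //; apply: reach_mono => ? ?; rewrite parents_set_key.
- by move=> w1 w2 q; rewrite !rank_set_key; apply: vf_inj gI _ _ _.
- move=> q i; rewrite full_set_key rank_set_key => iq qf.
  by have [w wq rw] := vf_rank gI iq qf; exists w; rewrite ?rank_set_key.
- by move=> kd2 w q; rewrite parents_set_key ranked_set_key; apply: vf_ranked gI kd2 _ _.
Qed.

Lemma pot_set_key A vp : pot A g' vp = pot A g vp.
Proof.
rewrite /pot domf_upd; apply: eq_bigr => w _.
rewrite /node_pot full_set_key parents_set_key /above.
by case: (vp w) => //= q; rewrite full_set_key.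
Qed.
End SetKey.

Section NewNode.
Variables (g : graph K I) (u v : nat) (e : I) (k : K) (r : nat).
Let g' : graph K I := (upd g u (set_item None)).[v <- new_node e k r].

Lemma fnd_new w : g'.[? w] = if w == v then Some (new_node e k r)
  else (hollow_node g u).[? w].
Proof. by rewrite fnd_set. Qed.

Lemma domf_new : domf g' = v |` domf g.
Proof. by rewrite dom_setf domf_upd. Qed.

Lemma full_new w : full g' w = (w == v) || (w != u) && full g w.
Proof.
rewrite -full_hollow /full /item_of fnd_new; by case: eqP.
Qed.

Lemma rank_new w : rank_of g' w = if w == v then r else rank_of g w.
Proof. by rewrite -(rank_hollow g u) /rank_of fnd_new; case: eqP. Qed.

Lemma parents_new w : parents_of g' w = if w == v then [::] else parents_of g w.
Proof. by rewrite -(parents_hollow g u) /parents_of fnd_new; case: eqP. Qed.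

Lemma ranked_new w : ranked_of g' w = (w != v) && ranked_of g w.
Proof. by rewrite -(ranked_hollow g u) /ranked_of fnd_new; case: eqP. Qed.
End NewNode.

Section MoveChildren.
Variables (g : graph K I) (u v : nat) (S : {fset nat}).
Let g' := map_nodes (fun w a =>
  if w \in S
  then set_parents [seq if p == u then v else p | p <- parents a] a
  else a) g.

Lemma full_move w : full g' w = full g w.
Proof. by rewrite /full /item_of fnd_map_nodes; case: g.[? w] => //= a; case: ifP. Qed.

Lemma rank_move w : rank_of g' w = rank_of g w.
Proof. by rewrite /rank_of fnd_map_nodes; case: g.[? w] => //= a; case: ifP. Qed.

Lemma ranked_move w : ranked_of g' w = ranked_of g w.
Proof. by rewrite /ranked_of fnd_map_nodes; case: g.[? w] => //= a; case: ifP. Qed.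

Lemma parents_move w : parents_of g' w =
  if w \in S then move_arc u v (parents_of g w) else parents_of g w.
Proof.
by rewrite /parents_of fnd_map_nodes; case: g.[? w] => /= [a|]; case: ifP.
Qed.
End MoveChildren.

Section AddArc.
Variables (g : graph K I) (u v : nat).
Let g' := upd g u (fun a => set_parents (rcons (parents a) v) a).

Lemma full_add_arc w : full g' w = full g w.
Proof. by rewrite /full /item_of fnd_upd; case: eqP => // _; case: g.[? w]. Qed.

Lemma rank_add_arc w : rank_of g' w = rank_of g w.
Proof. by rewrite /rank_of fnd_upd; case: eqP => // _; case: g.[? w]. Qed.

Lemma ranked_add_arc w : ranked_of g' w = ranked_of g w.
Proof. by rewrite /ranked_of fnd_upd; case: eqP => // _; case: g.[? w]. Qed.

Lemma parents_add_arc w : u \in domf g -> parents_of g' w =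
  if w == u then rcons (parents_of g w) v else parents_of g w.
Proof.
by rewrite in_domf /parents_of fnd_upd; case: eqP => // ->; case: g.[? u].
Qed.
End AddArc.

Lemma in_children g u w :
  (w \in children g u) = (w \in domf g) && (u \in parents_of g w).
Proof. by rewrite in_fset inE. Qed.

(** Apart from one unit, the time counts the ranked children that stay with [u]. They are virtual
    children of rank at least [rank_of g u - 2], so [fibre_count] allows at most two. *)
Lemma shift_decreased kd g vp u v e k t g1 : vforest kd g vp ->
  v \notin domf g -> full g u ->
  shift kd (upd g u (set_item None)).[v <- new_node e k (rank_of g u - 2)] u v t g1 ->
  t <= 3 /\ exists S, decreased kd g u v S g1.
Proof.
move=> gI vd fu; have ud := full_domf fu.
have uv : u != v by apply: contraNneq vd => <-.
set g0 := _.[v <- _].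
have dom0 : domf g0 = v |` domf g := domf_new _ _ _ _ _ _.
have full0 w : full g0 w = (w == v) || (w != u) && full g w := full_new _ _ _ _ _ _ _.
have rank0 w : rank_of g0 w = if w == v then rank_of g u - 2 else rank_of g w
  := rank_new _ _ _ _ _ _ _.
have parents0 w : parents_of g0 w = if w == v then [::] else parents_of g w
  := parents_new _ _ _ _ _ _ _.
have ranked0 w : ranked_of g0 w = (w != v) && ranked_of g w
  := ranked_new _ _ _ _ _ _ _.
have ch w : (w \in children g0 u) = (w \in domf g) && (u \in parents_of g w).
  rewrite in_children dom0 parents0 in_fset1U.
  by have [->|wv] := eqVneq w v; rewrite // (negbTE vd).
have rk w : w != v -> rank_of g0 w = rank_of g w.
  by move=> wv; rewrite rank0 (negbTE wv).
case=> {t g1} [S SC SR|kd2]; last first.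
  split=> //; exists pred0; split=> //.
  - by rewrite domf_upd dom0.
  - by rewrite full_add_arc full0 eqxx.
  - by move=> w wv; rewrite full_add_arc full0 (negbTE wv).
  - by rewrite rank_add_arc rank0 eqxx.
  - by move=> w wv; rewrite rank_add_arc rk.
  - by move=> w wv; rewrite ranked_add_arc ranked0 wv.
  - by rewrite parents_add_arc ?dom0 ?inE ?ud ?orbT // eq_sym (negbTE uv) parents0 eqxx.
  - move=> w wv; rewrite parents_add_arc ?dom0 ?inE ?ud ?orbT // kd2 /=.
    by rewrite parents0 (negbTE wv).
  - by rewrite kd2.
have kd1 : ~~ two_parent kd by case: (kd) SR.
(* The multi-root and one-root rules for [S] are reduced to what they share, their effect on ranked
   children. *)
have {}SR w : ranked_of g w -> u \in parents_of g w ->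
    (w \in S) = (rank_of g w < rank_of g u - 2).
  move=> rw uw; have wd : w \in domf g.
    by rewrite in_domf; move: rw; rewrite /ranked_of; case: g.[? w].
  have wv : w != v by apply: contraNneq vd => <-.
  have cw : w \in children g0 u by rewrite ch wd.
  have rw0 : ranked_of g0 w by rewrite ranked0 wv.
  have r0 : (rank_of g0 w < rank_of g0 v) = (rank_of g w < rank_of g u - 2).
    by rewrite rk // rank0 eqxx.
  by rewrite -r0; case: (kd) SR => // SR; apply: SR.
have sv w : w \in S -> w != v.
  move=> wS; apply: contraNneq vd => <-.
  by move: (fsubsetP SC _ wS); rewrite ch => /andP[].
split.
  rewrite leq_add2l // (@leq_trans (\sum_(w <- domf g)
    ((vp w == Some u) && (rank_of g u - 2 <= rank_of g w)))) //; last first.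
    by apply: leq_trans (fibre_count u _ gI) _; lia.
  rewrite -sum_fset; apply: fsubset_leq_card; apply/fsubsetP => w.
  rewrite in_fset inE ch => /andP[/andP[wd uw] /andP[rw wS]].
  have wv : w != v by apply: contraNneq vd => <-.
  rewrite ranked0 wv in rw.
  rewrite !inE wd /=; rewrite SR // in wS; rewrite leqNgt wS andbT.
  have := vf_parents gI w; rewrite (negbTE kd1) andbF.
  have vr q : parents_of g w = [:: q] -> vp w = Some q := vf_ranked gI kd1 rw.
  case: (parents_of g w) uw vr => [|p [|]] //.
  by rewrite inE => /eqP <- /(_ _ erefl) ->.
exists (mem S); split=> //.
- by rewrite full_move full0 eqxx.
- by move=> w wv; rewrite full_move full0 (negbTE wv).
- by rewrite rank_move rank0 eqxx.
- by move=> w wv; rewrite rank_move rk.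
- by move=> w wv; rewrite ranked_move ranked0 wv.
- by rewrite parents_move parents0 eqxx; case: ifP => // /sv; rewrite eqxx.
- by move=> w wv; rewrite parents_move parents0 (negbTE wv) (negbTE kd1).
- by move=> _ w /(fsubsetP SC); rewrite ch => /andP[].
Qed.

(** A change of key at a root leaves the potential alone. Otherwise 13 is 1 + 3 for the time and 9
    for the new node and the exposed virtual children. *)
Lemma decrease_key_amortized A kd v e k h t h' vp :
  vforest kd (nodes h) vp -> v \notin domf (nodes h) ->
  decrease_key_heap kd v e k h t h' ->
  exists vp', [/\ vforest kd (nodes h') vp',
    t + pot A (nodes h') vp' <= pot A (nodes h) vp + (3 * A + 13) &
    domf (nodes h') `<=` v |` domf (nodes h)].
Proof.
move=> gI vd; case=> {t h'} [u a m m' _ _ _ _ _ _|u a m m' t g1 g2 ua ae _ _ _ sh jn] /=.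
  exists vp; split; [exact: vforest_set_key| |by rewrite domf_upd fsubsetUr].
  rewrite pot_set_key; lia.
have fu : full (nodes h) u by rewrite /full /item_of ua /= ae.
have ra : rank a = rank_of (nodes h) u by rewrite /rank_of ua.
rewrite ra in sh; have [t3 [S dec]] := shift_decreased gI vd fu sh.
have [I2 p2 d2] := join_amortized A (vforest_decrease gI dec) jn.
exists (vp_decrease (nodes h) vp u v); split=> //; last by rewrite d2 (dec_domf dec).
by have := pot_decrease A gI dec; rewrite p2; lia.
Qed.
End HeapOperations.

(** * Melding and rebuilding *)

Section MeldRebuild.
Local Open Scope fset_scope.
Local Open Scope nat_scope.
Context {d : Order.disp_t} {K : orderType d} {I : Type}.
Implicit Types (kd : kind) (g : graph K I) (h : heap K I) (u v w x p q l i t : nat).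
Implicit Types (vp : nat -> option nat).

Section Union.
Variables (kd : kind) (g1 g2 : graph K I) (vp1 vp2 : nat -> option nat).
Hypothesis dis : [disjoint domf g1 & domf g2].
Hypotheses (I1 : vforest kd g1 vp1) (I2 : vforest kd g2 vp2).
Let g := catf g1 g2.

Definition vp_union w := if w \in domf g2 then vp2 w else vp1 w.

Lemma full_catf w : full g w = if w \in domf g2 then full g2 w else full g1 w.
Proof. by rewrite /full /item_of fnd_cat; case: ifP. Qed.

Lemma rank_catf w : rank_of g w = if w \in domf g2 then rank_of g2 w else rank_of g1 w.
Proof. by rewrite /rank_of fnd_cat; case: ifP. Qed.

Lemma parents_catf w :
  parents_of g w = if w \in domf g2 then parents_of g2 w else parents_of g1 w.
Proof. by rewrite /parents_of fnd_cat; case: ifP. Qed.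

Lemma ranked_catf w :
  ranked_of g w = if w \in domf g2 then ranked_of g2 w else ranked_of g1 w.
Proof. by rewrite /ranked_of fnd_cat; case: ifP. Qed.

Let vp1_out w q : vp1 w = Some q -> w \notin domf g2 /\ q \notin domf g2.
Proof. by case/(vf_vp I1) => wd qd _; rewrite !(fdisjointP dis). Qed.

Let vp2_in w q : vp2 w = Some q -> w \in domf g2 /\ q \in domf g2.
Proof. by case/(vf_vp I2). Qed.

Lemma vp_unionP w q : vp_union w = Some q <-> vp1 w = Some q \/ vp2 w = Some q.
Proof.
rewrite /vp_union; case: ifP => wd; split; auto; case=> //.
  by case/vp1_out; rewrite wd.
by case/vp2_in; rewrite wd.
Qed.

Lemma vforest_union : vforest kd g vp_union.
Proof.
split.
- by move=> w; rewrite full_catf parents_catf; case: ifP => _;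
    [apply: vf_parents I2 w | apply: vf_parents I1 w].
- move=> w q /vp_unionP[] wq.
    have [wd qd] := vp1_out wq; rewrite !rank_catf domf_cat !inE.
    by rewrite (negbTE wd) (negbTE qd) !orbF; apply: (vf_vp I1).
  have [wd qd] := vp2_in wq; rewrite !rank_catf domf_cat !inE.
  by rewrite wd qd !orbT; case: (vf_vp I2 wq).
- move=> w q /vp_unionP[] wq.
    have [/negbTE wd _] := vp1_out wq; have := vf_reach I1 wq.
    rewrite parents_catf ranked_catf wd; case: two_parent => //.
    apply: reach_mono => u p pu _; rewrite parents_catf.
    have /(fdisjointP dis)/negbTE -> // : u \in domf g1.
    by rewrite in_domf; move: pu; rewrite /parents_of; case: g1.[? u].
  have [wd _] := vp2_in wq; have := vf_reach I2 wq.
  rewrite parents_catf ranked_catf wd; case: two_parent => //.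
  apply: reach_mono => u p pu _; rewrite parents_catf.
  have -> // : u \in domf g2.
  by rewrite in_domf; move: pu; rewrite /parents_of; case: g2.[? u].
- move=> w1 w2 q /vp_unionP[] w1q /vp_unionP[] w2q; rewrite !rank_catf.
  + have [/negbTE -> _] := vp1_out w1q; have [/negbTE -> _] := vp1_out w2q.
    exact: (vf_inj I1 w1q w2q).
  + by have [_] := vp1_out w1q; have [_ ->] := vp2_in w2q.
  + by have [_] := vp1_out w2q; have [_ ->] := vp2_in w1q.
  + have [-> _] := vp2_in w1q; have [-> _] := vp2_in w2q.
    exact: (vf_inj I2 w1q w2q).
- move=> q i; rewrite !rank_catf full_catf; case: ifP => qd iq h.
    have [w wq rw] := vf_rank I2 iq h; exists w; first by apply/vp_unionP; right.
    by rewrite rank_catf; have [-> _] := vp2_in wq.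
  have [w wq rw] := vf_rank I1 iq h; exists w; first by apply/vp_unionP; left.
  by rewrite rank_catf; have [/negbTE -> _] := vp1_out wq.
- move=> kd2 w q; rewrite ranked_catf parents_catf /vp_union.
  by case: ifP => _; [apply: vf_ranked I2 kd2 _ _ | apply: vf_ranked I1 kd2 _ _].
Qed.

Lemma pot_union A : pot A g vp_union = pot A g1 vp1 + pot A g2 vp2.
Proof.
rewrite /pot domf_cat (big_fsetID _ (mem (domf g2))) /= addnC; congr (_ + _).
  rewrite (_ : [fset _ | _ in _ & _] = domf g1); last first.
    apply/fsetP => w; rewrite in_fset !inE /=.
    by case: (boolP (w \in domf g1)) => [/(fdisjointP dis)->|_] //=; case: (_ \in _).
  rewrite !big_seq; apply: eq_bigr => w /(fdisjointP dis)/negbTE wd.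
  rewrite /node_pot full_catf parents_catf wd /above /vp_union wd.
  case E: (vp1 w) => [q|] //=; rewrite full_catf.
  by have [_ /negbTE ->] := vp1_out E.
rewrite (_ : [fset _ | _ in _ & _] = domf g2); last first.
  apply/fsetP => w; rewrite in_fset !inE /=.
  by case: (w \in domf g2); rewrite ?orbT ?andbF.
rewrite !big_seq; apply: eq_bigr => w wd.
rewrite /node_pot full_catf parents_catf wd /above /vp_union wd.
case E: (vp2 w) => [q|] //=; rewrite full_catf.
by have [_ ->] := vp2_in E.
Qed.
End Union.

Lemma meld_amortized A kd h1 h2 h vp1 vp2 :
  [disjoint domf (nodes h1) & domf (nodes h2)] ->
  vforest kd (nodes h1) vp1 -> vforest kd (nodes h2) vp2 ->
  meld_heaps kd h1 h2 h ->
  exists vp, [/\ vforest kd (nodes h) vp,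
    pot A (nodes h) vp <= pot A (nodes h1) vp1 + pot A (nodes h2) vp2 &
    domf (nodes h) `<=` domf (nodes h1) `|` domf (nodes h2)].
Proof.
move=> dis I1 I2; case=> {h} [_|_|m1 m2 g m _ _ jn].
- by exists vp2; rewrite leq_addl fsubsetUr.
- by exists vp1; rewrite leq_addr fsubsetUl.
have [Ig pg dg] := join_amortized A (vforest_union dis I1 I2) jn.
by exists (vp_union (nodes h2) vp1 vp2); split=> //;
  [rewrite pg (pot_union dis I1 I2) | rewrite /= dg domf_cat].
Qed.

(** With all ranks 0 and no ranked child, the empty virtual forest fulfils every condition. This is
    the situation of a new node, of the empty heap and of both methods of rebuilding. *)
Lemma vforest_flat kd g :
  (forall u, [/\ rank_of g u = 0, size (parents_of g u) <= 1 & ~~ ranked_of g u]) ->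
  vforest kd g (fun _ => None).
Proof.
move=> fl; split=> //.
- by move=> u; have [_ h _] := fl u; apply: leq_trans h _.
- by move=> q i; have [-> _ _] := fl q.
- by move=> _ u q; have [_ _ /negbTE ->] := fl u.
Qed.

Lemma pot_flat A g : (forall u, u \in domf g -> full g u) ->
  pot A g (fun _ => None) = 3 * num_nodes g.
Proof.
move=> gf; rewrite /num_nodes card_fset_sum1 big_distrr /= /pot !big_seq.
by apply: eq_bigr => u ud; rewrite /node_pot gf.
Qed.

Lemma vforest_single kd v (e : I) (k : K) :
  vforest kd [fmap].[v <- new_node e k 0] (fun _ => None).
Proof.
apply: vforest_flat => u.
by rewrite /rank_of /parents_of /ranked_of fnd_set fnd_fmap0; case: eqP.
Qed.

Lemma domf_single v (a : node K I) : domf ([fmap].[v <- a] : graph K I) = [fset v].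
Proof. by rewrite dom_setf domf0 fsetU0. Qed.

Lemma pot_single A v (e : I) (k : K) :
  pot A [fmap].[v <- new_node e k 0] (fun _ => None) = 3.
Proof.
rewrite pot_flat /num_nodes domf_single ?cardfs1 // => u.
by rewrite inE => /eqP ->; rewrite /full /item_of fnd_set eqxx.
Qed.

Lemma num_arcs_le kd g vp : vforest kd g vp -> num_arcs g <= 2 * num_nodes g.
Proof.
move=> gI; rewrite /num_nodes card_fset_sum1 big_distrr /=.
by apply: leq_sum => u _; apply: leq_trans (vf_parents gI u) _; case: (_ && _).
Qed.

Lemma pot_hollow_nodes A g vp : A * (num_nodes g - num_items g) <= pot A g vp.
Proof.
rewrite /num_items sum_fset /num_nodes card_fset_sum1.
rewrite (eq_bigr (fun u => full g u + ~~ full g u)); last by move=> u _; case: full.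
rewrite big_split /= addKn big_distrr; apply: leq_sum => u _; rewrite /node_pot.
by case: full => //=; rewrite ?muln0 // muln1 leq_pmulr.
Qed.

Lemma full_roots_nodes g : full_roots g <= num_nodes g.
Proof.
by rewrite /num_nodes card_fset_sum1; apply: leq_sum => u _; case: full_root.
Qed.

Lemma in_full_nodes g u : (u \in full_nodes g) = full g u.
Proof. by rewrite in_fset inE; apply: andb_idl => /full_domf. Qed.

Lemma fnd_single_nodes g u : (single_nodes g).[? u] =
  if full g u then omap (fun a => Node (item a) (key a) 0 [::] false) g.[? u]
  else None.
Proof. by rewrite fnd_map_nodes fnd_restrict in_full_nodes; case: ifP. Qed.

Lemma nearest_full_size g u ps : nearest_full g u ps -> size ps <= 1.
Proof. by elim. Qed.

(** The factor 7 stands for one unit per node, at most two arcs per node, at most one link per node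
    and a new potential of at most 3 per node. The potential [A] of each hollow node pays for all
    this. *)
Lemma rebuild_amortized A kd h t h' vp : vforest kd (nodes h) vp ->
  7 * num_nodes (nodes h) <= A * (num_nodes (nodes h) - num_items (nodes h)) ->
  rebuild kd h t h' ->
  exists vp', [/\ vforest kd (nodes h') vp',
    t + pot A (nodes h') vp' <= pot A (nodes h) vp,
    domf (nodes h') = full_nodes (nodes h) &
    num_nodes (nodes h') = num_items (nodes h')].
Proof.
move=> gI hA.
have arcs := num_arcs_le gI; have hp := pot_hollow_nodes A (nodes h) vp.
have nN : num_items (nodes h) <= num_nodes (nodes h).
  apply: fsubset_leq_card; apply/fsubsetP => u.
  by rewrite in_full_nodes; apply: full_domf.
(* Both methods end with exactly the full nodes and no virtual parents, so the new potential is 3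
   per item. *)
suff flat g : domf g = full_nodes (nodes h) -> (forall u, u \in domf g -> full g u) ->
   pot A g (fun _ => None) <= 3 * num_nodes (nodes h) /\ num_nodes g = num_items g.
  case=> {t h'} [t g m|g [dg [g1 _ cg]]] /=.
    set s := single_nodes _.
    have Is : vforest kd s (fun _ => None).
      apply: vforest_flat => u; rewrite /rank_of /parents_of /ranked_of.
      by rewrite fnd_single_nodes; case: ifP; case: (nodes h).[? u].
    have ds : domf s = full_nodes (nodes h).
      apply/fsetP => u; rewrite in_full_nodes in_domf fnd_single_nodes.
      by rewrite /full /item_of; case: (nodes h).[? u] => [[[]]|].
    have fs u : u \in domf s -> full s u.
      rewrite ds in_full_nodes => fu; rewrite /full /item_of fnd_single_nodes fu.
      by move: fu; rewrite /full /item_of; case: (nodes h).[? u].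
    have [ps ns] := flat _ ds fs.
    have fr : full_roots s <= num_nodes (nodes h).
      by apply: leq_trans (full_roots_nodes s) _; rewrite /num_nodes ds.
    move=> gt _; suff [Ig pg tle [dg fg]] : [/\ vforest kd g (fun _ => None),
        pot A g (fun _ => None) = pot A s (fun _ => None), t <= full_roots s &
        domf g = domf s /\ forall u, full g u = full s u].
      exists (fun _ => None); split; [by []|lia|by rewrite dg|].
      rewrite /num_items /num_nodes; congr (#|` _|); apply/fsetP => u.
      rewrite in_full_nodes fg; apply/idP/idP; last by rewrite dg; apply: full_domf.
      by rewrite dg; apply: fs.
    have unr : exhaust unranked_link s t g -> [/\ vforest kd g (fun _ => None),
        pot A g (fun _ => None) = pot A s (fun _ => None), t <= full_roots s &
        domf g = domf s /\ forall u, full g u = full s u].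
      by case=> /(iterate_unranked A Is)[? -> -> ? ?] _; rewrite leq_addr.
    by case: (kd) Is gt unr => Is; [case=> -> ->| |]; auto.
  have fg u : u \in domf g -> full g u.
    rewrite dg => uf; have := uf; rewrite in_full_nodes /full /item_of.
    case e: (nodes h).[? u] => [a|] //=.
    by have [ps _ ->] := cg _ _ uf e.
  have [pg ng] := flat _ dg fg; exists (fun _ => None); split=> //; last by lia.
  apply: vforest_flat => u; rewrite /rank_of /parents_of /ranked_of.
  case: (boolP (u \in domf g)) => [|ud]; last by rewrite not_fnd.
  move=> uf; rewrite dg in uf; have := uf; rewrite in_full_nodes => /full_domf.
  rewrite in_domf; case e: (nodes h).[? u] => [a|] // _.
  by have [ps /nearest_full_size h1 ->] := cg _ _ uf e.
move=> dg fg; rewrite pot_flat //; split.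
  by rewrite /num_nodes dg leq_mul2l.
rewrite /num_nodes /num_items; congr (#|` _|); apply/fsetP => u.
by rewrite in_full_nodes; apply/idP/idP; [apply: fg | apply: full_domf].
Qed.
End MeldRebuild.

Import Order.TTheory GRing.Theory Num.Theory.

(** * Sequences of operations *)

Section Executions.
Local Open Scope fset_scope.
Local Open Scope nat_scope.
Context {d : Order.disp_t} {K : orderType d} {I : Type} {R : realType}.
Variables (kd : kind) (c : R) (A : nat).
Hypothesis c_gt1 : (1 < c)%R.
Hypothesis A_ge : (7 * c <= A%:R * (c - 1))%R.
Implicit Types (g : graph K I) (h : heap K I) (s : state K I) (u v w x y p t : nat).
Implicit Types (vp : nat -> option nat).

Let A_gt0 : 0 < A.
Proof. by have := A_ge; case: A => [|a] //; rewrite mul0r; have := c_gt1; lra. Qed.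

(** If c n < N, then N - n exceeds N (c - 1) / c, and by [A_ge] this times [A] is at least 7 N. *)
Lemma needs_rebuild_large h : needs_rebuild c h ->
  7 * num_nodes (nodes h) <= A * (num_nodes (nodes h) - num_items (nodes h)).
Proof.
rewrite /needs_rebuild; set N := num_nodes _; set n := num_items _ => cn.
have nN : n <= N.
  rewrite -(ler_nat R); apply: le_trans (ltW cn).
  by rewrite ler_peMl // ltW.
rewrite -(ler_nat R) !natrM natrB //.
have c0 : (0 < c)%R by apply: lt_trans c_gt1.
rewrite -(ler_pM2l c0).
have N0 : (0 <= N%:R :> R)%R by [].
have A0 : (0 <= A%:R :> R)%R by [].
have h1 := ler_wpM2r N0 A_ge.
have h2 := ler_wpM2l A0 (ltW cn).
lra.
Qed.

(** Rebuilding is paid entirely by the potential it releases. Afterwards all nodes are full, and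
    since c > 1 the heap does not need rebuilding again. *)
Lemma rebuild_if_amortized h t h' vp : vforest kd (nodes h) vp ->
  rebuild_if kd c h t h' ->
  exists vp', [/\ vforest kd (nodes h') vp',
    t + pot A (nodes h') vp' <= pot A (nodes h) vp,
    domf (nodes h') `<=` domf (nodes h) & ~~ needs_rebuild c h'].
Proof.
move=> hI; case=> {t h'} [nr|t h' nr rb]; first by exists vp; split.
have [vp' [I' le' dom' nn]] := rebuild_amortized hI (needs_rebuild_large nr) rb.
exists vp'; split=> //.
  by rewrite dom'; apply/fsubsetP => u; rewrite in_full_nodes; apply: full_domf.
by rewrite /needs_rebuild nn -leNgt ler_peMl // ltW.
Qed.

(** The potential is only bounded by [p], because the virtual forest is not part of the heap and is
    known merely to exist. The second clause keeps N at most c n between operations. *)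
Definition heap_potential h p :=
  [/\ exists2 vp, vforest kd (nodes h) vp & pot A (nodes h) vp <= p &
    ~~ needs_rebuild c h].

(** Melding merges the node maps, which is faithful only if no node name occurs in both. *)
Definition disjoint_heaps s := forall x y hx hy, x != y ->
  s.[? x] = Some hx -> s.[? y] = Some hy ->
  [disjoint domf (nodes hx) & domf (nodes hy)].

Definition state_potential s (F : nat) := exists P : nat -> nat,
  [/\ F = \sum_(x <- domf s) P x,
    forall x h, s.[? x] = Some h -> heap_potential h (P x) &
    disjoint_heaps s].

Lemma state_potential_set s F x h p : state_potential s F ->
  x \notin domf s -> heap_potential h p ->
  (forall y hy, y != x -> s.[? y] = Some hy ->
     [disjoint domf (nodes hy) & domf (nodes h)]) ->
  state_potential s.[x <- h] (p + F).
Proof.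
move=> [P [-> Ph dis]] xs hp dh; exists (fun y => if y == x then p else P y); split.
- rewrite dom_setf big_fsetU1 // eqxx; congr (_ + _); rewrite !big_seq.
  by apply: eq_bigr => y ys; case: eqP ys xs => // -> ->.
- move=> y hy; rewrite fnd_set; case: eqP => [_ [<-] //|_]; exact: Ph.
- move=> y z hy hz yz; rewrite !fnd_set.
  have [yx|yx] := eqVneq y x; have [zx|zx] := eqVneq z x.
  + by rewrite yx zx eqxx in yz.
  + by case=> <- e; rewrite fdisjoint_sym; apply: dh e.
  + by move=> e [<-]; apply: dh e.
  + exact: dis.
Qed.

(** The heap that an operation acts on is taken out with its share of the potential, to be put back
    afterwards by [state_potential_set]. *)
Lemma state_potential_rem s F x h : state_potential s F -> s.[? x] = Some h ->
  exists p F', [/\ F = p + F', heap_potential h p, state_potential s.[~ x] F' &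
    forall y hy, y != x -> s.[~ x].[? y] = Some hy ->
      [disjoint domf (nodes hy) & domf (nodes h)]].
Proof.
move=> [P [-> Ph dis]] xh; have xs : x \in domf s by rewrite -fndSome xh.
exists (P x), (\sum_(y <- domf s `\ x) P y); split.
- by rewrite (big_fsetD1 x).
- exact: Ph.
- exists P; split.
  + by rewrite domf_rem.
  + by move=> y hy; rewrite fnd_rem1; case: eqP => // _; apply: Ph.
  + move=> y z hy hz yz; rewrite !fnd_rem1; case: (y =P x) => // _.
    by case: (z =P x) => // _; apply: dis.
- by move=> y hy yx; rewrite fnd_rem1 yx => e; apply: dis e xh.
Qed.

Lemma setf_rem1 s x h : s.[~ x].[x <- h] = s.[x <- h].
Proof.
apply/fmapP => y; rewrite !fnd_set fnd_rem1; by case: eqP.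
Qed.

Lemma state_potential_update s x F h vp :
  state_potential s.[~ x] F ->
  (forall y hy, y != x -> s.[~ x].[? y] = Some hy ->
      [disjoint domf (nodes hy) & domf (nodes h)]) ->
  vforest kd (nodes h) vp -> ~~ needs_rebuild c h ->
  state_potential s.[x <- h] (pot A (nodes h) vp + F).
Proof.
move=> sF dis hI nr; rewrite -setf_rem1; apply: state_potential_set => //.
  by rewrite domf_rem !inE eqxx.
by split=> //; exists vp.
Qed.

Definition rank_cost s x :=
  oapp (fun h : heap K I => (rank_bound (nodes h)).+1) 0 s.[? x].

Definition op_cost s (o : op K I) :=
  match o with
  | DeleteMin x | Delete _ x => rank_cost s x
  | _ => 1
  end.

Lemma delete_step s F x h u t1 h1 t2 h2 : state_potential s F ->
  s.[? x] = Some h -> delete_node kd u h t1 h1 -> rebuild_if kd c h1 t2 h2 ->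
  exists F', state_potential s.[x <- h2] F' /\
    t1 + t2 + F' <= F + (3 * A + 13) * rank_cost s x.
Proof.
move=> sF xh del rb; rewrite /rank_cost xh /=.
have [p [F' [-> [[vp hI hp] nr] sF' dis]]] := state_potential_rem sF xh.
have [vp1 [I1 le1 sub1]] := delete_node_amortized A_gt0 hI del.
have [vp2 [I2 le2 sub2 nr2]] := rebuild_if_amortized I1 rb.
exists (pot A (nodes h2) vp2 + F'); split.
  apply: (state_potential_update sF' _ I2 nr2) => y hy yx /(dis _ _ yx).
  rewrite !(fdisjoint_sym (domf (nodes hy))).
  by apply: fdisjointWl; apply: fsubset_trans sub2 sub1.
have : (2 * A + 8) * (rank_bound (nodes h)).+1 <=
    (3 * A + 13) * (rank_bound (nodes h)).+1.
  by rewrite leq_mul2r; apply/orP; right; lia.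
lia.
Qed.

Lemma fresh_disjoint s v x y hy h : fresh_node s v ->
  s.[~ x].[? y] = Some hy -> [disjoint domf (nodes hy) & domf (nodes h)] ->
  [disjoint v |` domf (nodes h) & domf (nodes hy)].
Proof.
move=> fr; rewrite fnd_rem1; case: eqP => // _ /fr vy dis.
by rewrite fdisjointUX fdisjoint1X vy fdisjoint_sym.
Qed.

(** The factor [3 * A + 13] is dictated by decrease-key; it also covers the [2 * A + 8] of deletions
    and the constants of the other operations. Rebuilding adds nothing. *)
Lemma step_amortized s F o t s' : state_potential s F -> step kd c s o t s' ->
  exists F', state_potential s' F' /\ t + F' <= F + (3 * A + 13) * op_cost s o.
Proof.
move=> sF; case=> {o t s'}.
- move=> x xs; exists (0 + F); split; last by rewrite /=; lia.
  apply: state_potential_set => //; last by move=> y hy _ _; rewrite fdisjointX0.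
  split; last first.
    rewrite /needs_rebuild /num_nodes domf0 cardfs0 -leNgt mulr_ge0 //.
    by rewrite ltW // (lt_trans _ c_gt1).
  exists (fun _ => None); last first.
    by rewrite pot_flat /num_nodes ?domf0 ?cardfs0 // => u; rewrite inE.
  by apply: vforest_flat => u; rewrite /rank_of /parents_of /ranked_of fnd_fmap0.
- by move=> x xs; exists F; split=> //=; lia.
- move=> e k x h v h1 t h2 xh _ fr ml rb /=.
  have [p [F' [-> [[vp hI hp] nr] sF' dis]]] := state_potential_rem sF xh.
  have dv : [disjoint domf (nodes (Heap [fmap].[v <- new_node e k 0] (Some v)))
      & domf (nodes h)].
    by rewrite domf_single fdisjoint1X; apply: fr xh.
  have [vp1 [I1 le1 sub1]] := meld_amortized A dv (vforest_single kd v e k) hI ml.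
  have [vp2 [I2 le2 sub2 nr2]] := rebuild_if_amortized I1 rb.
  exists (pot A (nodes h2) vp2 + F'); split; last first.
    by rewrite /= pot_single in le1; lia.
  apply: (state_potential_update sF' _ I2 nr2) => y hy yx yh.
    have := fresh_disjoint fr yh (dis _ _ yx yh).
    rewrite (fdisjoint_sym (domf (nodes hy))); apply: fdisjointWl.
    by rewrite domf_single in sub1; apply: fsubset_trans sub2 sub1.
- move=> x h u t1 h1 t2 h2 xh _ del rb; exact: delete_step sF xh del rb.
- move=> x y hx hy h1 t h2 xy xh yh _ ml rb /=.
  have [q [Fy [-> [[vpy hIy hpy] nry] sFy disy]]] := state_potential_rem sF yh.
  have xh' : s.[~ y].[? x] = Some hx by rewrite fnd_rem1 xy.
  have [p [F' [-> [[vpx hIx hpx] nrx] sF' disx]]] := state_potential_rem sFy xh'.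
  have [vp1 [I1 le1 sub1]] := meld_amortized A (disy _ _ xy xh') hIx hIy ml.
  have [vp2 [I2 le2 sub2 nr2]] := rebuild_if_amortized I1 rb.
  exists (pot A (nodes h2) vp2 + F'); split; last by lia.
  apply: (state_potential_update sF' _ I2 nr2) => z hz zx zh; rewrite fdisjoint_sym.
    apply: fdisjointWl (fsubset_trans sub2 sub1) _.
    rewrite fdisjointUX !(fdisjoint_sym _ (domf (nodes hz))) (disx _ _ zx zh) /=.
    have zh' : s.[~ y].[? z] = Some hz by move: zh; rewrite fnd_rem1 zx.
    by apply: disy (zh'); apply/eqP => zy; rewrite zy fnd_rem1 eqxx in zh'.
- move=> e k x h v t1 h1 t2 h2 xh fr dk rb /=.
  have [p [F' [-> [[vp hI hp] nr] sF' dis]]] := state_potential_rem sF xh.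
  have [vp1 [I1 le1 sub1]] := decrease_key_amortized A hI (fr _ _ xh) dk.
  have [vp2 [I2 le2 sub2 nr2]] := rebuild_if_amortized I1 rb.
  exists (pot A (nodes h2) vp2 + F'); split; last first.
    by lia.
  apply: (state_potential_update sF' _ I2 nr2) => y hy yx yh; rewrite fdisjoint_sym.
    apply: fdisjointWl (fsubset_trans sub2 sub1) _.
    exact: fresh_disjoint fr yh (dis _ _ yx yh).
- move=> e x h u t1 h1 t2 h2 xh _ del rb; exact: delete_step sF xh del rb.
Qed.

(** * From ranks to logarithms and the final bounds *)

Definition log_factor : R := (2 + 2 * (1 + ln c) / ln 2)%R.

(** Between operations N is at most c n, so its logarithm to base two is at most (ln c + ln n) / ln
    2; [log_factor] absorbs this and the additive 2 into a multiple of 1 + ln n. The full node makes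
    N and n positive, as the rules for ln require. *)
Lemma rank_cost_le h u : full (nodes h) u -> ~~ needs_rebuild c h ->
  ((rank_bound (nodes h)).+1%:R <=
    log_factor * (1 + ln (num_items (nodes h))%:R) :> R)%R.
Proof.
move=> fu; rewrite /needs_rebuild -leNgt; set N := num_nodes _.
set n := num_items _ => Nc.
have n0 : 0 < n by rewrite cardfs_gt0; apply/fset0Pn; exists u; rewrite in_full_nodes.
have N0 : 0 < N.
  by rewrite cardfs_gt0; apply/fset0Pn; exists u; apply: full_domf.
have ln2 : (0 < ln 2 :> R)%R by rewrite ln_gt0 // ltr1n.
have lnc : (0 <= ln c)%R by rewrite ln_ge0 // ltW.
have lnn : (0 <= ln n%:R :> R)%R by rewrite ln_ge0 // ler1n.
have c0 : (0 < c)%R by apply: lt_trans c_gt1.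
have log : ((trunc_log 2 N)%:R * ln 2 <= ln c + ln n%:R :> R)%R.
  rewrite mulr_natl -lnXn // -lnM ?posrE ?ltr0n //.
  rewrite ler_ln ?posrE ?exprn_gt0 ?mulr_gt0 ?ltr0n //.
  by apply: le_trans Nc; rewrite -natrX ler_nat trunc_logP.
have {}log : ((trunc_log 2 N)%:R <= (ln c + ln n%:R) / ln 2 :> R)%R.
  by rewrite ler_pdivlMr.
have -> : (rank_bound (nodes h)).+1 = 2 * trunc_log 2 N + 2.
  by rewrite addn2 /rank_bound mul2n.
rewrite natrD natrM /log_factor.
have i2 : (0 < (ln 2)^-1 :> R)%R by rewrite invr_gt0.
move: log i2 lnc lnn.
move: (ln c) (ln n%:R) ((ln 2)^-1)%R ((trunc_log 2 N)%:R)%R => a b i L.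
move=> h1 h2 h3 h4.
have h5 : (0 <= i * (1 + a * b))%R by rewrite mulr_ge0 ?addr_ge0 ?mulr_ge0 // ltW.
lra.
Qed.

Lemma amortized_bound_ge1 s o t s' : step kd c s o t s' ->
  (1 <= amortized_bound R s o)%R.
Proof.
have del h x u t1 h1 : s.[? x] = Some h -> delete_node kd u h t1 h1 ->
    (1 <= 1 + ln (items_in s x)%:R :> R)%R.
  move=> xh dn; have fu : full (nodes h) u by case: dn.
  rewrite lerDl ln_ge0 // ler1n /items_in xh /= cardfs_gt0.
  by apply/fset0Pn; exists u; rewrite in_full_nodes.
by case=> //= *; apply: del; eassumption.
Qed.

Lemma op_cost_le s F o t s' : state_potential s F -> step kd c s o t s' ->
  ((op_cost s o)%:R <= log_factor * amortized_bound R s o)%R.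
Proof.
move=> [P [_ Ph _]].
(* This settles the operations whose claimed bound is constant. *)
have ge1 : (1 <= log_factor * 1)%R.
  rewrite mulr1 /log_factor; have : (0 <= 2 * (1 + ln c) / ln 2)%R; last by lra.
  by rewrite divr_ge0 ?mulr_ge0 ?addr_ge0 ?ln_ge0 ?ler1n // ltW.
have del h x u t1 h1 : s.[? x] = Some h -> delete_node kd u h t1 h1 ->
    ((rank_cost s x)%:R <= log_factor * (1 + ln (items_in s x)%:R))%R.
  move=> xh dn; have fu : full (nodes h) u by case: dn.
  by rewrite /rank_cost /items_in xh /=; apply: rank_cost_le fu (Ph _ _ xh).2.
by case=> //= *; apply: del; eassumption.
Qed.

(** The inequalities of [step_amortized] telescope from potential 0. The nonnegative sum of bounds
    later allows the constant to be enlarged. *)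
Lemma execution_amortized (os : seq (op K I)) ts (bs : seq R) s :
  execution kd c os ts bs s ->
  exists F, [/\ state_potential s F, (0 <= \sum_(b <- bs) b)%R &
    ((\sum_(t <- ts) t%:R) + F%:R <=
      (3 * A + 13)%:R * log_factor * \sum_(b <- bs) b)%R].
Proof.
elim=> [|{}os {}ts {}bs {}s o t s' _ [F [sF b0 le]] st].
  exists 0; rewrite !big_nil mulr0 addr0; split=> //.
  exists (fun _ => 0); split; first by rewrite big1.
    by move=> x h; rewrite fnd_fmap0.
  by move=> x y hx hy _; rewrite fnd_fmap0.
have [F' [sF' le']] := step_amortized sF st.
have b1 := amortized_bound_ge1 st; have oc := op_cost_le sF st.
exists F'; rewrite -!cats1 !big_cat !big_seq1 /=; split=> //.
  by rewrite addr_ge0 // (le_trans _ b1).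
move: le'; rewrite -(ler_nat R) !natrD natrM => le'.
have := ler_wpM2l (ler0n R (3 * A + 13)) oc; rewrite mulrA => oc'.
rewrite mulrDr; lra.
Qed.

(** At most two arcs enter each node, hence the factor 3, and there are at most c nodes per item. *)
Lemma space_le h F : heap_potential h F ->
  ((space_used h)%:R <= 3 * c * (num_items (nodes h))%:R)%R.
Proof.
case=> [[vp /num_arcs_le arcs _]]; rewrite /needs_rebuild -leNgt => Nc.
have : space_used h <= 3 * num_nodes (nodes h) by rewrite mulSn leq_add2l.
by rewrite -(ler_nat R) natrM => /le_trans; apply; rewrite -mulrA ler_wpM2l.
Qed.
End Executions.

Theorem theorem5p1 (R : realType) (kd : kind) (c : R) (hc : 1 < c) :
  exists C : R,
    forall (d : Order.disp_t) (K : orderType d) (I : Type)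
           (os : seq (op K I)) (ts : seq nat) (bs : seq R)
           (s : state K I),
      execution kd c os ts bs s ->
      \sum_(t <- ts) t%:R <= C * \sum_(b <- bs) b /\
      (forall (x : nat) (h : heap K I), s.[? x] = Some h ->
         (space_used h)%:R <= C * (num_items (nodes h))%:R).
Proof.
have c1 : 0 < c - 1 by rewrite subr_gt0.
have c0 : 0 < c by apply: lt_trans hc.
have [A A_ge] : exists A : nat, 7 * c <= A%:R * (c - 1).
  (* Any integer above 7 c / (c - 1) will do, as c - 1 is positive. *)
  exists (Num.truncn (7 * c / (c - 1))).+1.
  by rewrite -ler_pdivrMr // ltW // truncnS_gt.
have D0 : 0 <= (3 * A + 13)%:R * log_factor c.
  rewrite mulr_ge0 // /log_factor addr_ge0 //.
  by rewrite divr_ge0 ?mulr_ge0 ?addr_ge0 ?ln_ge0 ?ler1n // ltW.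
(* The sum of the time and space constants serves both claims, since both are nonnegative. *)
exists ((3 * A + 13)%:R * log_factor c + 3 * c) => d K I os ts bs s ex.
have [F [sF b0 le]] := execution_amortized hc A_ge ex; split.
  apply: le_trans (_ : _ <= (3 * A + 13)%:R * log_factor c * \sum_(b <- bs) b) _.
    by apply: le_trans le; rewrite lerDl.
  by rewrite ler_wpM2r // lerDl mulr_ge0 // ltW.
move=> x h xh; case: sF => P [_ Ph _].
apply: le_trans (space_le (Ph _ _ xh)) _.
by rewrite ler_wpM2r // lerDr.
Qed.
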